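(* Let $H$ be a strictly $2$-balanced graph. Then the RPS number satisfies $$\mathrm{RPS}(H,n)=O\bigl(n^{1/m_2(H)}\log n\bigr)\quad\text{as } n\to\infty,$$ where the implicit constant may depend on $H$.
   Context: For a graph $F$ write $v_F:=|V(F)|$ and $e_F:=|E(F)|$. For a graph $H$ define $$m_2(H):=\max_{F\subseteq H}\Bigl(\mathbf 1_{\{v_F\ge 3\}}\tfrac{e_F-1}{v_F-2}+\mathbf 1_{\{F=K_2\}}\tfrac12\Bigr),$$ where the maximum is over all subgraphs $F$ of $H$. (For $v_F\le 2$ the first term is interpreted as $0$.) The graph $H$ is called strictly $2$-balanced if $m_2(H)>m_2(F)$ for all proper subgraphs $F\subsetneq H$. Ramsey, Paper, Scissors game for $H$: this is a game between two players, Proposer and Decider, starting with the vertex set $V=\{1,2,\dots,n\}$ and no edges. In each turn, Proposer proposes a pair of non-adjacent vertices from $V$, and Decider simultaneously decides whether or not to add it as an edge to the current graph (without knowing which pair is proposed). Proposer cannot propose vertex-pairs that would form a copy of $H$ together with the current graph, nor vertex-pairs that have been proposed before. The game ends when no pair can be legally proposed any more; the graph at that time is the final graph. Both players may use randomized strategies. The RPS number $\mathrm{RPS}(H,n)$ is the largest number $k$ for which Proposer can guarantee that, with probability at least $1/2$ (regardless of Decider's strategy), the final graph has an independent set of size $k$. *)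

(* Defs.v *)
From HB Require Import structures.
From mathcomp Require Import all_boot all_order all_algebra.
From mathcomp Require Import all_classical all_reals all_analysis.

Set Implicit Arguments.
Unset Strict Implicit.
Unset Printing Implicit Defensive.

Import Order.TTheory GRing.Theory Num.Theory.

Local Open Scope ring_scope.

(** * Finite simple graphs and the 2-density *)

(* Vertices are taken in an ambient finite type [T], so that subgraphs of a
   graph are again graphs over [T]. *)
Definition is_graph (T : finType) (G : {set T} * {set {set T}}) : bool :=
  [forall e in G.2, (e \subset G.1) && (#|e| == 2)%N].

Record graph (T : finType) := Graph {
  graph_val :> {set T} * {set {set T}};
  _ : is_graph graph_val }.

HB.instance Definition _ (T : finType) := [isSub for @graph_val T].
HB.instance Definition _ (T : finType) := [Finite of graph T by <:].

Definition verts (T : finType) (G : graph T) : {set T} := G.1.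
Definition edges (T : finType) (G : graph T) : {set {set T}} := G.2.

Definition subgraph (T : finType) (F H : graph T) : bool :=
  (verts F \subset verts H) && (edges F \subset edges H).

Definition proper_subgraph (T : finType) (F H : graph T) : bool :=
  subgraph F H && (F != H).

Definition is_K2 (T : finType) (F : graph T) : bool :=
  (#|verts F| == 2)%N && (#|edges F| == 1)%N.

(* If [#|verts F| = 2] the quotient is a division by zero, but it is then
   multiplied by the indicator, which vanishes. *)
Definition density2 (T : finType) (F : graph T) : rat :=
  (3 <= #|verts F|)%N%:R * ((#|edges F|%:R - 1) / (#|verts F|%:R - 2))
  + (is_K2 F)%:R * (1 / 2).

(* The default value 0 does not affect the maximum: it is the density of the
   subgraph without vertices. *)
Definition m2 (T : finType) (H : graph T) : rat :=
  \big[Num.max/0]_(F : graph T | subgraph F H) density2 F.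

Definition strictly_2balanced (T : finType) (H : graph T) : Prop :=
  forall F : graph T, proper_subgraph F H -> m2 F < m2 H.

(** * The Ramsey, Paper, Scissors game on the vertex set ['I_n] *)

(* [E] is the edge set of a graph on all of ['I_n]; copies of [H] need not be
   induced. *)
Definition contains_copy (T : finType) (H : graph T) (n : nat)
    (E : {set {set 'I_n}}) : bool :=
  [exists f : {ffun T -> 'I_n},
     dinjectiveb f (verts H) && [forall e in edges H, (f @: e) \in E]].

(* The completed turns, most recent first: the proposed pair, and whether
   Decider added it. *)
Definition history (n : nat) : Type := seq ({set 'I_n} * bool).

Definition proposed (n : nat) (h : history n) : {set {set 'I_n}} :=
  [set e | e \in map fst h].

Definition current (n : nat) (h : history n) : {set {set 'I_n}} :=
  [set e | (e, true) \in h].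

Definition legal (T : finType) (H : graph T) (n : nat) (h : history n)
    (e : {set 'I_n}) : bool :=
  [&& #|e| == 2, e \notin current h, e \notin proposed h
    & ~~ contains_copy H (e |: current h)]%N.

Definition game_over (T : finType) (H : graph T) (n : nat)
    (h : history n) : bool :=
  ~~ [exists e, legal H h e].

(* Both players randomize independently at every turn, knowing all previous
   turns; in particular Decider's choice does not depend on the pair that is
   being proposed. *)

(* [s h] is the probability distribution of the pair proposed after [h]. *)
Definition proposer_strategy (R : realType) (T : finType) (H : graph T)
    (n : nat) (s : history n -> {set 'I_n} -> R) : Prop :=
  forall h, ~~ game_over H h ->
    [/\ forall e, 0 <= s h e,
        forall e, ~~ legal H h e -> s h e = 0
      & \sum_e s h e = 1].

(* [d h] is the probability that Decider adds the pair proposed after [h]. *)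
Definition decider_strategy (R : realType) (n : nat)
    (d : history n -> R) : Prop :=
  forall h, 0 <= d h <= 1.

(* The probability that the final graph satisfies [A], when the play continues
   from [h] for at most [m] turns. *)
Fixpoint prob_from (R : realType) (T : finType) (H : graph T) (n : nat)
    (s : history n -> {set 'I_n} -> R) (d : history n -> R)
    (A : pred {set {set 'I_n}}) (m : nat) (h : history n) : R :=
  if m is m'.+1 then
    if game_over H h then (A (current h))%:R
    else \sum_e s h e * (d h * prob_from H s d A m' ((e, true) :: h)
                + (1 - d h) * prob_from H s d A m' ((e, false) :: h))
  else (A (current h))%:R.

(* No pair is proposed twice, so the game ends within ['C(n, 2)] turns. *)
Definition prob_final (R : realType) (T : finType) (H : graph T) (n : nat)
    (s : history n -> {set 'I_n} -> R) (d : history n -> R)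
    (A : pred {set {set 'I_n}}) : R :=
  prob_from H s d A 'C(n, 2) [::].

Definition has_independent_set (n k : nat) (E : {set {set 'I_n}}) : bool :=
  [exists S : {set 'I_n},
     (#|S| == k)%N && [forall e in E, ~~ (e \subset S)]].

Definition proposer_guarantees (R : realType) (T : finType) (H : graph T)
    (n k : nat) : Prop :=
  exists2 s : history n -> {set 'I_n} -> R, proposer_strategy H s &
    forall d : history n -> R, decider_strategy d ->
      1 / 2 <= prob_final H s d (has_independent_set k).

(* The maximum is over a nonempty set ([k = 0] is always guaranteed) which
   contains no [k > n]. *)
Definition RPS (R : realType) (T : finType) (H : graph T) (n : nat) : nat :=
  \max_(k < n.+1 | `[< proposer_guarantees R H n k >]) k.

(* Main.v *)
(* Decider accepts each pair independently with probability [p = c n^(-1/m2(H))].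
   Whatever Proposer does, the final graph [F] is then contained in a random
   graph [X] that has every pair as an edge independently with probability [p],
   and every edge [e] of [X] outside [F] closes a copy of [H] in [F + e].  So if
   [K] is independent in [F], every edge of [X] inside [K] lies in a copy of [H]
   with no other edge inside [K].

   For [|K| = k = C (log n) / p], with probability [1 - exp(- 3 k log n)] there
   are at least [p k^2 / 16] such edges.  Choose a maximal family of pairs of
   overlapping copies whose unions are edge-disjoint.  As [H] is strictly
   2-balanced, overlapping costs a power of [n], and the family has only [O(k)]
   members.  No edge of [X] lies in more than [O(log n)] copies each of which has
   an edge of its own, so the family meets [O(k log n)] copies only.  The other
   copies are edge-disjoint, and for small [c] there are fewer of them than
   [p k^2 / 32].  For large [C] this is a contradiction, with enough room for a
   union bound over all [K]. *)

Require Import Defs.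
From mathcomp Require Import all_boot all_order all_algebra.
From mathcomp Require Import all_reals.
From mathcomp Require Import zify ring lra.

Set Implicit Arguments.
Unset Strict Implicit.
Unset Printing Implicit Defensive.

Import Order.TTheory GRing.Theory Num.Theory.

Local Open Scope ring_scope.

(** * Random subsets *)

Lemma card_bigcup_disjoint (I U : finType) (A : {set I}) (F : I -> {set U}) :
  (forall i j, i \in A -> j \in A -> i != j -> [disjoint F i & F j]) ->
  #|\bigcup_(i in A) F i| = (\sum_(i in A) #|F i|)%N.
Proof.
elim: {A}#|A| {-2}A (erefl #|A|) => [|k IH] A.
  by move/eqP; rewrite cards_eq0 => /eqP -> _; rewrite !big_set0 cards0.
move=> cA dA; have /card_gt0P [i iA] : (0 < #|A|)%N by rewrite cA.
rewrite (big_setD1 i) //= (big_setD1 i iA) /= cardsU IH; first last.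
- by move=> j l /setD1P[_ jA] /setD1P[_ lA]; apply: dA.
- by move: cA; rewrite (cardsD1 i) iA => -[].
suff -> : F i :&: \bigcup_(j in A :\ i) F j = set0 by rewrite cards0 subn0.
apply/setP => u; rewrite !inE; apply/negP => /andP[ui /bigcupP [j /setD1P[ji jA] uj]].
have := dA i j iA jA; rewrite eq_sym ji => /(_ isT) /disjointFr /(_ ui).
by rewrite uj.
Qed.

Section RandomSubset.
Variables (R : realFieldType) (U : finType) (p : R).
Hypothesis p01 : 0 <= p <= 1.

(* The random subset of [U] which contains every element independently with
   probability [p]. *)
Definition subset_weight (X : {set U}) : R :=
  \prod_u (if u \in X then p else 1 - p).

Definition expect (phi : {set U} -> R) : R :=
  \sum_X subset_weight X * phi X.

Definition prob (A : pred {set U}) : R := expect (fun X => (A X)%:R).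

Lemma subset_weight_ge0 X : 0 <= subset_weight X.
Proof.
case/andP: p01 => p0 p1; apply: prodr_ge0 => u _.
by case: ifP; rewrite ?subr_ge0.
Qed.

(** Independence in product form: expanding the right side gives one term per subset. Inclusion
    probabilities and the lower tail below follow by a choice of the factors. *)
Lemma expect_prod (a b : U -> R) :
  expect (fun X => \prod_u (if u \in X then a u else b u)) =
  \prod_u (p * a u + (1 - p) * b u).
Proof.
rewrite bigA_distr; apply: eq_big => //= X _.
rewrite -big_split; apply: eq_bigr => u _.
by case: ifP.
Qed.

Lemma expect_le phi psi : (forall X, phi X <= psi X) -> expect phi <= expect psi.
Proof.
by move=> le; apply: ler_sum => X _; rewrite ler_wpM2l ?subset_weight_ge0.
Qed.

Lemma expect_sum (I : finType) (Q : pred I) (phi : I -> {set U} -> R) :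
  expect (fun X => \sum_(i | Q i) phi i X) = \sum_(i | Q i) expect (phi i).
Proof. by rewrite exchange_big; apply: eq_bigr => X _; rewrite mulr_sumr. Qed.

Lemma expectZ a phi : expect (fun X => a * phi X) = a * expect phi.
Proof. by rewrite mulr_sumr; apply: eq_bigr => X _; rewrite mulrCA. Qed.

Lemma expect1 : expect (fun=> 1) = 1.
Proof.
transitivity (expect (fun X => \prod_u (if u \in X then 1 else 1))).
  by apply: eq_bigr => X _; rewrite big1 // => u _; case: ifP.
rewrite expect_prod big1 // => u _; ring.
Qed.

Lemma expect_ge a phi : (forall X, a <= phi X) -> a <= expect phi.
Proof.
move=> le; rewrite -[leLHS]mulr1 -[X in a * X <= _]expect1 -expectZ.
by apply: expect_le => X; rewrite mulr1.
Qed.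

Lemma prob_sub (A : {set U}) : prob (fun X => A \subset X) = p ^+ #|A|.
Proof.
transitivity (expect (fun X => \prod_u (if u \in X then 1
                                        else (u \notin A)%:R))).
  apply: eq_bigr => X _; congr (_ * _); case: (boolP (A \subset X)) => [sAX|].
    rewrite big1 // => u _; case: ifP => // uX.
    by rewrite (contra (subsetP sAX u)) ?uX.
  case/subsetPn => u uA uX.
  by rewrite (bigD1 u) //= (negPf uX) uA mul0r.
rewrite expect_prod -prodr_const [RHS]big_mkcond /=; apply: eq_bigr => u _.
by case: (u \in A) => /=; ring.
Qed.

Lemma prob_le (A B : pred {set U}) : (forall X, A X -> B X) -> prob A <= prob B.
Proof.
move=> sAB; apply: expect_le => X; rewrite ler_nat.
by case AX: (A X); rewrite // sAB.
Qed.

Lemma prob_exists_le (I : finType) (Q : pred I) (A : I -> pred {set U}) :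
  prob (fun X => [exists i, Q i && A i X]) <= \sum_(i | Q i) prob (A i).
Proof.
rewrite -expect_sum; apply: expect_le => X.
case: existsP => [[i /andP[Qi Ai]]|_]; last by apply: sumr_ge0.
by rewrite (bigD1 i) //= Ai lerDl sumr_ge0.
Qed.

Lemma prob_or_le (A B : pred {set U}) :
  prob (fun X => A X || B X) <= prob A + prob B.
Proof.
rewrite -big_split /=; apply: ler_sum => X _; rewrite -mulrDr.
rewrite ler_wpM2l ?subset_weight_ge0 // -natrD ler_nat.
by case: (A X); case: (B X).
Qed.

(** Chernoff's lower tail: Markov's inequality for [y ^+ #|X :&: B|], which is at least [y ^+ t] on
    the event and whose expectation factorizes. *)
Lemma prob_card_lt (B : {set U}) (t : nat) (y : R) : 0 < y <= 1 ->
  prob (fun X => #|X :&: B| < t)%N <= y ^- t * (1 - p * (1 - y)) ^+ #|B|.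
Proof.
case/andP=> y0 y1; rewrite -ler_pdivrMl ?invr_gt0 ?exprn_gt0 // invrK -expectZ.
apply: le_trans (_ : expect (fun X => \prod_u (if u \in X then
   (if u \in B then y else 1) else 1)) <= _); last first.
  rewrite expect_prod -prodr_const [leRHS]big_mkcond.
  by rewrite le_eqVlt; apply/orP/or_introl/eqP/eq_bigr => u _; case: ifP => _; ring.
apply: expect_le => X.
have -> : \prod_u (if u \in X then if u \in B then y else 1 else 1) =
          y ^+ #|X :&: B|.
  rewrite -prodr_const [RHS]big_mkcond; apply: eq_bigr => u _.
  by rewrite inE; case: (u \in X); case: (u \in B).
case: ltnP => lt; rewrite ?mulr1 ?mulr0 ?exprn_ge0 ?ler_wiXn2l ?(ltW y0) //.
exact: ltnW.
Qed.

Definition disjoint_family (I : finType) (Q : pred I) (F : I -> {set U})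
    (m : nat) (X : {set U}) : bool :=
  [exists A : {set I}, [&& m <= #|A|,
     [forall i in A, Q i && (F i \subset X)] &
     [forall i in A, forall j in A, (i != j) ==> [disjoint F i & F j]]]]%N.

(* Markov's inequality for [x ^+ #|A|], summed over all disjoint families. *)
Lemma prob_disjoint_family (I : finType) (Q : pred I) (F : I -> {set U})
    (m : nat) (x : R) : 1 <= x ->
  prob (disjoint_family Q F m) <= x ^- m * \prod_(i | Q i) (1 + x * p ^+ #|F i|).
Proof.
move=> x1; have x0 : 0 < x by apply: lt_le_trans x1.
have p0 : 0 <= p by case/andP: p01.
pose D (A : {set I}) := [&& m <= #|A|, [forall i in A, Q i] &
  [forall i in A, forall j in A, (i != j) ==> [disjoint F i & F j]]]%N.
apply: le_trans (_ : \sum_(A | D A)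
   prob (fun X => \bigcup_(i in A) F i \subset X) <= _).
  apply: le_trans (prob_exists_le D (fun A X => \bigcup_(i in A) F i \subset X)).
  apply: prob_le => X /existsP[A /and3P[mA /forall_inP QA dA]]; apply/existsP.
  exists A; rewrite /D mA dA /= andbT; apply/andP; split.
    by apply/forall_inP => i /QA /andP[].
  by apply/bigcupsP => i /QA /andP[].
rewrite -ler_pdivrMl ?invr_gt0 ?exprn_gt0 // invrK mulr_sumr.
(* The constraints of size and disjointness are dropped; the sum over all [A] is then the expansion
   of the product. *)
apply: le_trans (_ : \sum_(A : {set I}) \prod_i
   (if i \in A then (Q i)%:R * (x * p ^+ #|F i|) else 1) <= _); last first.
  rewrite -bigA_distr le_eqVlt; apply/orP/or_introl/eqP.
  rewrite [RHS]big_mkcond; apply: eq_bigr => i _.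
  by case: (Q i) => /=; ring.
rewrite big_mkcond /=; apply: ler_sum => A _.
have nonneg i : 0 <= (Q i)%:R * (x * p ^+ #|F i|).
  by rewrite !mulr_ge0 ?exprn_ge0 ?ler0n // ltW.
case: ifP => [/and3P[mA /forall_inP QA /forall_inP dA]|_]; last first.
  by apply: prodr_ge0 => i _; case: ifP.
rewrite prob_sub -big_mkcond /=.
rewrite (eq_bigr (fun i => x * p ^+ #|F i|)); last by move=> i /QA ->; rewrite mul1r.
rewrite big_split /= prodr_const prodrXr.
rewrite (card_bigcup_disjoint (fun i j iA jA => implyP (forall_inP (dA i iA) j jA))).
by rewrite ler_wpM2r ?exprn_ge0 // ler_weXn2l.
Qed.

(** Conditioning on whether [e] lies in [X]: the counterpart of one turn of the game. *)
Lemma expect_resample (e : U) phi :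
  expect phi = p * expect (fun X => phi (e |: X))
             + (1 - p) * expect (fun X => phi (X :\ e)).
Proof.
have split_at (F : {set U} -> R) :
    \sum_X F X = \sum_(X : {set U} | e \notin X) (F X + F (e |: X)).
  rewrite (bigID (fun X : {set U} => e \notin X)) /= big_split /=; congr (_ + _).
  rewrite (reindex_onto (fun X => e |: X) (fun X => X :\ e)) /=; last first.
    by move=> X; rewrite negbK => /setD1K.
  apply: eq_bigl => X; rewrite negbK setU11 /=.
  case: (boolP (e \in X)) => eX; last by rewrite setU1K ?eqxx.
  apply/eqP => /setP /(_ e); rewrite !inE eqxx eX.
  by [].
rewrite /expect !split_at !mulr_sumr -big_split /=; apply: eq_bigr => X eX.
have [w0 wX wU] : exists2 w0, subset_weight X = (1 - p) * w0 &
                             subset_weight (e |: X) = p * w0.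
  exists (\prod_(u | u != e) (if u \in X then p else 1 - p)).
    by rewrite /subset_weight (bigD1 e) //= (negPf eX).
  rewrite /subset_weight (bigD1 e) //= setU11; congr (_ * _).
  by apply: eq_bigr => u ue; rewrite !inE (negPf ue).
have -> : e |: (e |: X) = e |: X by rewrite setUA setUid.
have -> : X :\ e = X.
  by apply/setP => u; rewrite !inE; case: eqP => // ->; rewrite (negPf eX).
rewrite setU1K // wX wU; ring.
Qed.

End RandomSubset.

(** * Extending partial copies *)

Section ImageGraph.
Variables (V N : finType) (EH : {set {set V}}).
Implicit Types (f : {ffun V -> N}).

Definition img (f : {ffun V -> N}) : {set {set N}} :=
  [set f @: e | e : {set V} in EH].

Lemma img_edge f e : e \in EH -> f @: e \in img f.
Proof. exact: imset_f. Qed.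

Lemma imgP f g : reflect (exists2 e, e \in EH & g = f @: e) (g \in img f).
Proof. exact: imsetP. Qed.

Lemma card_img f : injectiveb f -> #|img f| = #|EH|.
Proof. by move/injectiveP => injf; rewrite card_imset //; apply: imset_inj. Qed.

Lemma card_imgD f (U : {set {set N}}) : injectiveb f ->
  #|img f :\: U| = (#|EH| - #|[set e in EH | f @: e \in U]|)%N.
Proof.
move=> /injectiveP injf; set D := [set e in EH | _].
have sD : D \subset EH by apply/subsetP => e; rewrite inE => /andP[].
have -> : img f :\: U = [set f @: e | e : {set V} in EH :\: D].
  apply/setP => g; rewrite !inE; apply/andP/imsetP.
    case=> gU /imgP [e eE ge]; exists e => //.
    by rewrite !inE eE andbT -ge gU.
  case=> e; rewrite !inE => /andP[eD eE] ->; rewrite img_edge //.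
  by move: eD; rewrite eE.
rewrite card_imset; last exact: imset_inj.
by rewrite cardsD (setIidPr sD).
Qed.

Lemma img_sub_range f g : g \in img f -> g \subset [set f x | x : V].
Proof. by case/imgP => e _ ->; apply: imsetS; apply/subsetP. Qed.

End ImageGraph.

Section FunctionSums.
Variables (R : realFieldType) (V N : finType).

Lemma prod_if_const (P : pred V) (a : R) :
  \prod_x (if P x then 1 else a) = a ^+ (#|V| - #|P|).
Proof.
rewrite (eq_bigr (fun x => if ~~ P x then a else 1)); last by move=> x _; case: (P x).
by rewrite -big_mkcond prodr_const -(cardC P) addKn.
Qed.

Lemma sum_ffun_prod (G : V -> N -> R) :
  \sum_(f : {ffun V -> N}) \prod_x G x (f x) = \prod_x \sum_y G x y.
Proof. by rewrite bigA_distr_bigA. Qed.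

Lemma sum_indicator (A : {set N}) : \sum_y (y \in A)%:R = #|A|%:R :> R.
Proof. by rewrite -natr_sum -sum1_card [in RHS]big_mkcond. Qed.

End FunctionSums.

(* With [q = n^(-1/(E - 1))] all relevant powers of [n] are integral powers of
   [q]: [n^-1 = q^(E - 1)] and [p = c n^(-1/m2(H)) = c q^(v - 2)]. *)
Section Extension.
Variables (R : realFieldType) (V N : finType) (EH : {set {set V}}).
Variables (q c p : R).
Local Notation v := #|V|.
Local Notation E := #|EH|.
Local Notation img := (img EH).
Local Notation a := (q ^+ E.-1).

Hypotheses (card_edge : forall e, e \in EH -> #|e| = 2%N).
Hypotheses (v_gt2 : (2 < v)%N) (E_gt1 : (1 < E)%N).
Implicit Types (f : {ffun V -> N}).
(** Strict balancedness in integers: placing the vertices outside [A] and paying for the edges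
    outside [D] gives [n ^ (v - #|A|) * p ^ (E - #|D|) <= q]. *)
Hypothesis balanced : forall (A : {set V}) (D : {set {set V}}),
  D \subset EH -> D != EH -> (forall e, e \in D -> e \subset A) -> (2 < #|A|)%N ->
  ((v - #|A|) * E.-1 < (E - #|D|) * (v - 2))%N.
Hypotheses (q01 : 0 < q <= 1) (c01 : 0 < c <= 1).
Hypotheses (p_def : p = c * q ^+ (v - 2)) (N_def : #|N|%:R * a = 1).

Let q0 : 0 < q. Proof. by case/andP: q01. Qed.
Let c0 : 0 < c. Proof. by case/andP: c01. Qed.
Let a0 : 0 < a. Proof. by rewrite exprn_gt0. Qed.
Let p0 : 0 < p. Proof. by rewrite p_def mulr_gt0 ?exprn_gt0. Qed.
Let p1 : p <= 1.
Proof.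
case/andP: q01 => _ q1; case/andP: c01 => _ c1.
by rewrite p_def mulr_ile1 ?exprn_ile1 ?exprn_ge0 ?(ltW q0) ?(ltW c0).
Qed.

Lemma p_expE : p ^+ E.-1 = c ^+ E.-1 * a ^+ (v - 2).
Proof. by rewrite p_def exprMn -!exprM mulnC. Qed.

(* The first alternative is the case in which the copy meets [W] in the edge
   [e0] only. *)
Lemma weight_dichotomy f (U : {set {set N}}) (W : {set N}) e0 :
  injectiveb f -> e0 \in EH -> f @: e0 \in U -> ~~ (img f \subset U) ->
  (forall g, g \in U -> g \subset W) ->
  p ^+ #|img f :\: U| <= c ^+ E.-1 * \prod_x (if x \in e0 then 1 else a)
  \/ p ^+ #|img f :\: U| <= q * \prod_x (if f x \in W then 1 else a).
Proof.
move=> injf e0E e0U nsub sUW; rewrite card_imgD //; set D := [set e in EH | _].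
pose A := [set x | f x \in W].
have sD : D \subset EH by apply/subsetP => e; rewrite inE => /andP[].
have DA e : e \in D -> e \subset A.
  rewrite inE => /andP[_ /sUW sW]; apply/subsetP => x xe; rewrite inE.
  by rewrite (subsetP sW) ?imset_f.
have e0D : e0 \in D by rewrite inE e0E.
have nD : D != EH.
  apply: contra nsub => /eqP DE; apply/subsetP => g /imgP [e eE ->].
  by move: eE; rewrite -DE inE => /andP[].
(* [A] collects the vertices sent into [W]. With three or more of them balancedness leaves a factor
   [q]; with two, [A = e0] and [D] is at most [{e0}], so at least [E - 1] edges are new. *)
case: (ltnP 2 #|A|) => [A3|A2]; [right|left].
  rewrite prod_if_const.
  have -> : #|[pred x | f x \in W]| = #|A| by apply: eq_card => x; rewrite !inE.
  rewrite -exprM -exprS p_def exprMn -exprM.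
  apply: le_trans (_ : q ^+ ((v - 2) * (E - #|D|)) <= _).
    rewrite ler_piMl ?exprn_ge0 ?(ltW q0) //.
    by case/andP: c01 => /ltW c0' c1; rewrite exprn_ile1.
  case/andP: q01 => /ltW q0' q1; rewrite ler_wiXn2l // mulnC.
  by rewrite [X in (_ < X)%N]mulnC; apply: balanced.
have eA : e0 = A by apply/eqP; rewrite eqEcard DA //= (card_edge e0E).
have /subset_leq_card : D \subset [set e0].
  apply/subsetP => e eD; rewrite inE eqEcard eA DA //=.
  rewrite -eA !card_edge //; by move: eD; rewrite inE => /andP[].
rewrite cards1 => D1; rewrite prod_if_const card_edge // -p_expE.
by rewrite ler_wiXn2l ?(ltW p0) // -subn1 leq_sub2l.
Qed.

(** The sum over maps factorizes over the vertices, each of which contributes at most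
    [#|W| + #|N| * a = #|W| + 1]. *)
Lemma sum_prod_region (W : {set N}) :
  \sum_(f : {ffun V -> N}) \prod_x (if f x \in W then 1 else a) <=
  (#|W|%:R + 1) ^+ v.
Proof.
rewrite (sum_ffun_prod (fun _ y => if y \in W then 1 else a)).
have v0 : (0 < v)%N by apply: ltn_trans v_gt2.
rewrite prodr_const ler_pXn2r ?nnegrE ?addr_ge0 ?ler0n ?ler01 //; last first.
  by apply: sumr_ge0 => y _; case: ifP => _; rewrite ?ler01 ?(ltW a0).
rewrite -[X in _ <= _ + X]N_def mulr_natl -sum_indicator -sumr_const -big_split.
apply: ler_sum => y _ /=; case: (y \in W); last by rewrite add0r.
by rewrite lerDl ltW.
Qed.

Lemma sum_prod_rooted e0 (g : {set N}) : e0 \in EH -> #|g| = 2%N ->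
  \sum_(f : {ffun V -> N}) \prod_x (if x \in e0 then (f x \in g)%:R else a) = 4.
Proof.
move=> e0E g2; rewrite (sum_ffun_prod (fun x y => if x \in e0 then (y \in g)%:R else a)).
rewrite (eq_bigr (fun x => if x \in e0 then 2 else 1)); last first.
  move=> x _; case: ifP => _; first by rewrite sum_indicator g2.
  by rewrite sumr_const -mulr_natl.
by rewrite -big_mkcond prodr_const card_edge // expr2 -natrM.
Qed.

Lemma sum_prod_rooted_in e0 (g K : {set N}) x0 :
  e0 \in EH -> #|g| = 2%N -> x0 \notin e0 ->
  \sum_(f : {ffun V -> N}) \prod_x (if x \in e0 then (f x \in g)%:R
     else if x == x0 then (f x \in K)%:R * a else a) = 4 * (#|K|%:R * a).
Proof.
move=> e0E g2 x0e; rewrite (sum_ffun_prod (fun x y => if x \in e0 then (y \in g)%:R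
     else if x == x0 then (y \in K)%:R * a else a)).
rewrite (eq_bigr (fun x => (if x \in e0 then 2 else 1) *
                           (if x == x0 then #|K|%:R * a else 1))).
  rewrite big_split /= -!big_mkcond prodr_const card_edge //.
  by rewrite big_pred1_eq expr2 -natrM.
move=> x _; case: ifP => xe; rewrite ?mul1r.
  by rewrite (negPf (memPn x0e _ xe)) mulr1 sum_indicator g2.
case: ifP => _; first by rewrite -mulr_suml sum_indicator.
by rewrite sumr_const -mulr_natl.
Qed.

(** This is the expected number of further copies through an edge [g] of [U], each paid for by its
    new edges only. It is small for small [c], the second term carrying a factor [q]. *)
Lemma sum_extend_edge (U : {set {set N}}) (W : {set N}) g :
  g \in U -> #|g| = 2%N -> (forall g', g' \in U -> g' \subset W) ->
  \sum_(f : {ffun V -> N} | [&& injectiveb f, g \in img f & ~~ (img f \subset U)])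
     p ^+ #|img f :\: U|
  <= 4 * E%:R * c ^+ E.-1 + q * (#|W|%:R + 1) ^+ v.
Proof.
move=> gU g2 sUW.
(* Both alternatives of the dichotomy are added, for every possible root edge [e0], which removes
   the conditions on [f]. *)
apply: le_trans (_ : \sum_(f : {ffun V -> N}) (\sum_(e0 in EH)
   c ^+ E.-1 * \prod_x (if x \in e0 then (f x \in g)%:R else a)
   + q * \prod_x (if f x \in W then 1 else a)) <= _); last first.
  rewrite big_split exchange_big /= -mulr_sumr lerD ?ler_wpM2l ?sum_prod_region ?(ltW q0) //.
  rewrite (eq_bigr (fun=> c ^+ E.-1 * 4)); last first.
    by move=> e0 e0E; rewrite -mulr_sumr sum_prod_rooted.
  by rewrite sumr_const -[leLHS]mulr_natl (mulrC 4) mulrAC mulrA lexx.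
have t1 (f : {ffun V -> N}) e0 : 0 <= c ^+ E.-1 * \prod_x (if x \in e0 then (f x \in g)%:R else a).
  by rewrite mulr_ge0 ?exprn_ge0 ?(ltW c0) // prodr_ge0 // => x _; case: ifP; rewrite ?ler0n ?ltW.
have t2 (f : {ffun V -> N}) : 0 <= q * \prod_x (if f x \in W then 1 else a).
  by rewrite mulr_ge0 ?(ltW q0) // prodr_ge0 // => x _; case: ifP; rewrite ?ler01 ?ltW.
rewrite big_mkcond; apply: ler_sum => f _.
case: ifP => [/and3P[injf /imgP [e0 e0E gE] nsub]|_]; last first.
  by rewrite addr_ge0 // sumr_ge0.
have [le|le] := weight_dichotomy injf e0E (eq_ind _ (fun x => x \in U) gU _ gE) nsub sUW.
  apply: le_trans le _; rewrite (bigD1 e0) //= -!addrA.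
  rewrite (eq_bigr (fun x => if x \in e0 then (f x \in g)%:R else a)).
    by rewrite lerDl addr_ge0 // sumr_ge0.
  by move=> x _; case: ifP => // xe; rewrite gE imset_f.
by apply: le_trans le _; rewrite lerDr sumr_ge0.
Qed.

(** A second copy that meets [f1] in one edge only also has an edge inside [K], hence a further
    vertex in [K], which costs [#|K| * a = #|K| / n]. Meeting [f1] in more costs a factor [q]. *)
Lemma sum_extend_overlap (f1 : {ffun V -> N}) (K : {set N}) : injectiveb f1 ->
  \sum_(f : {ffun V -> N} | [&& injectiveb f,
     [exists e0 in EH, (f @: e0 \in img f1) && ~~ (f @: e0 \subset K)] &
     [exists e in EH, (f @: e \subset K) && (f @: e \notin img f1)]])
     p ^+ #|img f :\: img f1|
  <= 4 * E%:R ^+ 2 * v%:R * c ^+ E.-1 * (#|K|%:R * a) + q * (v%:R + 1) ^+ v.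
Proof.
move=> injf1; pose W := [set f1 x | x : V].
have cW : #|W| = v by rewrite card_imset //; apply/injectiveP.
pose pure (f : {ffun V -> N}) (g : {set N}) (e0 : {set V}) x0 := c ^+ E.-1 *
  \prod_x (if x \in e0 then (f x \in g)%:R
     else if x == x0 then (f x \in K)%:R * a else a).
apply: le_trans (_ : \sum_(f : {ffun V -> N}) (\sum_(g in img f1) \sum_(e0 in EH)
   \sum_(x0 | x0 \notin e0) pure f g e0 x0
   + q * \prod_x (if f x \in W then 1 else a)) <= _); last first.
  have := sum_prod_region W; rewrite cW => leW.
  rewrite big_split /= -mulr_sumr lerD ?ler_wpM2l ?(ltW q0) //.
  rewrite exchange_big /=.
  set B := c ^+ E.-1 * (4 * (#|K|%:R * a)).
  have B0 : 0 <= B by rewrite !mulr_ge0 ?exprn_ge0 ?ler0n ?(ltW c0) ?(ltW q0).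
  apply: le_trans (_ : \sum_(g in img f1) E%:R * (v%:R * B) <= _); last first.
    rewrite sumr_const -[leLHS]mulr_natl card_img // /B.
    move: (_ ^+ _) (#|K|%:R * _) => y z; rewrite le_eqVlt; apply/orP; left; apply/eqP; ring.
  apply: ler_sum => g gU; rewrite exchange_big /= mulr_natl -sumr_const.
  apply: ler_sum => e0 e0E; rewrite exchange_big /= mulr_natl -cardsT -sumr_const.
  rewrite [leLHS]big_mkcond [leRHS]big_mkcond; apply: ler_sum => x0 _ /=; rewrite inE.
  case: ifP => [x0e|//]; rewrite /pure -mulr_sumr sum_prod_rooted_in //.
  case/imgP: gU => e eE ->; rewrite card_imset ?card_edge //; exact/injectiveP.
have t1 (f : {ffun V -> N}) g e0 x0 : 0 <= pure f g e0 x0.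
  rewrite mulr_ge0 ?exprn_ge0 ?(ltW c0) // prodr_ge0 // => x _.
  by do 2?case: ifP => _; rewrite ?mulr_ge0 ?ler0n ?exprn_ge0 ?(ltW q0).
have t2 (f : {ffun V -> N}) : 0 <= q * \prod_x (if f x \in W then 1 else a).
  by rewrite mulr_ge0 ?(ltW q0) // prodr_ge0 // => x _; case: ifP; rewrite ?ler01 ?ltW.
rewrite big_mkcond; apply: ler_sum => f _; case: ifP; last first.
  by move=> _; rewrite addr_ge0 //; do 3!apply: sumr_ge0 => ? _.
case/and3P=> injf /exists_inP [e0 e0E /andP[e0U e0K]] /exists_inP [e eE /andP[eK eU]].
have nsub : ~~ (img f \subset img f1).
  by apply: contra eU => /subsetP; apply; apply: img_edge.
have [le|le] := weight_dichotomy (W := W) injf e0E e0U nsub (@img_sub_range _ _ _ _); last first.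
  by apply: le_trans le _; rewrite lerDr; do 3!apply: sumr_ge0 => ? _.
(* [e] and [e0] differ, as only [e0] is mapped into [img f1]; being of equal size, [e] has a vertex
   outside [e0], and its image lies in [K]. *)
have [x0 x0e x0e0] : exists2 x, x \in e & x \notin e0.
  apply/subsetPn; apply: contra eU => see0.
  suff -> : e = e0 by [].
  by apply/eqP; rewrite eqEcard see0 !card_edge.
apply: le_trans le _.
have -> : c ^+ E.-1 * \prod_x (if x \in e0 then 1 else a) = pure f (f @: e0) e0 x0.
  congr (_ * _); apply: eq_bigr => x _; case: ifP => xe; first by rewrite imset_f.
  by case: eqP => // ->; rewrite (subsetP eK) ?imset_f // mul1r.
rewrite (bigD1 (f @: e0)) //= (bigD1 e0) //= (bigD1 x0) //= -!addrA.
by rewrite lerDl !addr_ge0 //; do ?apply: sumr_ge0 => ? _.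
Qed.

(** A copy has weight [p ^+ E = p * c ^+ E.-1 * a ^+ (v - 2)]: the ends of a chosen edge range over
    [K], and every other vertex contributes [#|N| * a = 1]. *)
Lemma sum_edge_inside (K : {set N}) :
  \sum_(f : {ffun V -> N} | injectiveb f && [exists e in EH, f @: e \subset K]) p ^+ #|img f|
  <= E%:R * #|K|%:R ^+ 2 * p * c ^+ E.-1.
Proof.
pose term (f : {ffun V -> N}) (e0 : {set V}) := p * c ^+ E.-1 *
  \prod_x (if x \in e0 then (f x \in K)%:R else a).
have t0 (f : {ffun V -> N}) e0 : 0 <= term f e0.
  rewrite !mulr_ge0 ?exprn_ge0 ?(ltW c0) ?(ltW p0) // prodr_ge0 // => x _.
  by case: ifP => _; rewrite ?ler0n ?ltW.
apply: le_trans (_ : \sum_(f : {ffun V -> N}) \sum_(e0 in EH) term f e0 <= _).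
  rewrite big_mkcond; apply: ler_sum => f _; case: ifP; last by rewrite sumr_ge0.
  case/andP=> injf /exists_inP [e eE eK]; rewrite card_img //.
  rewrite (bigD1 e) //= -[leLHS]addr0 lerD ?sumr_ge0 // /term.
  rewrite (eq_bigr (fun x => if x \in e then 1 else a)); last first.
    by move=> x _; case: ifP => // xe; rewrite (subsetP eK) ?imset_f.
  rewrite prod_if_const card_edge // -mulrA -p_expE -exprS prednK //.
  exact: ltnW.
rewrite exchange_big /=.
rewrite (eq_bigr (fun=> p * c ^+ E.-1 * #|K|%:R ^+ 2)).
  rewrite sumr_const -[leLHS]mulr_natl; move: (c ^+ _) (#|K|%:R) => y z.
  by rewrite le_eqVlt; apply/orP; left; apply/eqP; ring.
move=> e0 e0E; rewrite -mulr_sumr; congr (_ * _).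
rewrite (sum_ffun_prod (fun x y => if x \in e0 then (y \in K)%:R else a)).
rewrite (eq_bigr (fun x => if x \in e0 then #|K|%:R else 1)).
  by rewrite -big_mkcond prodr_const card_edge.
move=> x _; case: ifP => _; first by rewrite sum_indicator.
by rewrite sumr_const -mulr_natl.
Qed.

End Extension.

(** * Chains of copies and bad graphs *)

Lemma card_bigcup_le (I U : finType) (A : {set I}) (F : I -> {set U}) b :
  (forall i, i \in A -> #|F i| <= b)%N -> (#|\bigcup_(i in A) F i| <= #|A| * b)%N.
Proof.
move=> leb; rewrite -sum_nat_const.
apply: (@leq_trans (\sum_(i in A) #|F i|)); last exact: leq_sum.
elim/big_rec2: _ => [|i n B _ le]; first by rewrite cards0.
by rewrite cardsU (leq_trans (leq_subr _ _)) // leq_add2l.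
Qed.

Section Chains.
Variables (V N : finType) (EH : {set {set V}}).
Local Notation img := (img EH).
Implicit Types (X U F : {set {set N}}).

Definition has_copy F := [exists f : {ffun V -> N}, injectiveb f && (img f \subset F)].

(* [L] copies through [g] in [X] each of which has an edge of its own form a
   chain of length [L]; unlike such families, chains can be counted copy by
   copy. *)
Fixpoint chain L (g : {set N}) U X : bool :=
  if L is L'.+1 then
    [exists f : {ffun V -> N}, [&& injectiveb f, g \in img f, ~~ (img f \subset U),
       img f :\: U \subset X & chain L' g (U :|: img f) X]]
  else true.

(** The copies form a chain in any order: [e] is the only edge of [fe e] inside [K], so no copy
    taken earlier contains the own edge of a later one. *)
Lemma chain_of_family (fe : {set N} -> {ffun V -> N}) (K : {set N}) g X
    (s : seq {set N}) U :
  uniq s ->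
  (forall e, e \in s -> [/\ injectiveb (fe e), e \in img (fe e), e \subset K,
      g \in img (fe e) & img (fe e) \subset X]) ->
  (forall e e', e \in s -> e' \in img (fe e) -> e' \subset K -> e' = e) ->
  (forall e, e \in s -> e \notin U) ->
  chain (size s) g U X.
Proof.
elim: s U => //= e s IH U /andP[es us] fP fK sU; apply/existsP; exists (fe e).
have [injf eI eK gI sX] := fP e (mem_head _ _).
rewrite injf gI (subset_trans (subsetDl _ _) sX) /=; apply/andP; split.
  by apply: contra (sU e (mem_head _ _)) => /subsetP; apply.
apply: IH => // [e' e's|e' e'' e's|e' e's].
- by apply: fP; rewrite inE e's orbT.
- by apply: fK; rewrite inE e's orbT.
rewrite inE negb_or sU ?inE ?e's ?orbT //=; apply/negP => e'I.
have [_ _ e'K _ _] : [/\ injectiveb (fe e'), e' \in img (fe e'), e' \subset K,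
      g \in img (fe e') & img (fe e') \subset X] by apply: fP; rewrite inE e's orbT.
by move: es; rewrite -(fK e e' (mem_head _ _) e'I e'K) e's.
Qed.

End Chains.

Section ProbChain.
Variables (R : realFieldType) (V N : finType) (EH : {set {set V}}).
Variables (p B : R) (w : nat).
Hypothesis p01 : 0 <= p <= 1.
Hypothesis extend_le : forall g (U : {set {set N}}) (W : {set N}),
  g \in U -> #|g| = 2%N -> (forall g', g' \in U -> g' \subset W) -> (#|W| <= w)%N ->
  \sum_(f : {ffun V -> N} | [&& injectiveb f, g \in img EH f & ~~ (img EH f \subset U)])
    p ^+ #|img EH f :\: U| <= B.

(** Union bound over the first copy, then induction. [A] records the edges demanded of [X] so far,
    [U] those no longer charged; they differ because the root [g] need not belong to [X]. [W] bounds
    the vertices in use. *)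
Lemma prob_chain L g (U A : {set {set N}}) (W : {set N}) :
  g \in U -> #|g| = 2%N -> (forall g', g' \in U -> g' \subset W) ->
  (#|W| + #|V| * L <= w)%N -> A \subset U -> 0 <= B ->
  prob p (fun X => (A \subset X) && chain EH L g U X) <= p ^+ #|A| * B ^+ L.
Proof.
move=> + g2 + + + B0; have p0 : 0 <= p by case/andP: p01.
elim: L U W A => [|L IH] U W A gU UW cW sAU /=.
  rewrite mulr1 -prob_sub; apply: prob_le => // X; by rewrite andbT.
pose Q (f : {ffun V -> N}) := [&& injectiveb f, g \in img EH f & ~~ (img EH f \subset U)].
pose D f := A :|: (img EH f :\: U).
apply: (@le_trans _ _ (\sum_(f | Q f)
   prob p (fun X => (D f \subset X) && chain EH L g (U :|: img EH f) X))).
  apply: le_trans (prob_exists_le p01 Q _); apply: prob_le => // X.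
  case/andP=> AX /existsP [f /and5P[injf gf nsub sX ch]]; apply/existsP; exists f.
  by rewrite /Q injf gf nsub /D subUset AX sX ch.
have step f : Q f -> prob p (fun X => (D f \subset X) && chain EH L g (U :|: img EH f) X)
   <= p ^+ #|A| * B ^+ L * p ^+ #|img EH f :\: U|.
  move=> Qf; rewrite mulrAC -exprD.
  have -> : (#|A| + #|img EH f :\: U| = #|D f|)%N.
    rewrite cardsU (_ : A :&: _ = set0) ?cards0 ?subn0 //.
    apply/setP => x; rewrite !inE; case: (boolP (x \in A)) => //= xA.
    by rewrite (subsetP sAU).
  apply: (IH _ (W :|: [set f x | x : V])).
  - by rewrite inE gU.
  - move=> g'; rewrite inE => /orP[/UW s|/img_sub_range s]; apply: (subset_trans s).
      exact: subsetUl.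
    exact: subsetUr.
  - rewrite (leq_trans _ cW) // mulnS addnA leq_add2r cardsU (leq_trans (leq_subr _ _)) //.
    by rewrite leq_add2l (leq_trans (leq_imset_card _ _)).
  - by rewrite /D subUset (subset_trans sAU) ?subsetUl //= subDset setUA setUid subsetUr.
apply: le_trans (ler_sum _ step) _; rewrite -mulr_sumr exprSr mulrA.
rewrite ler_wpM2l ?mulr_ge0 ?exprn_ge0 // (extend_le gU g2 UW) //.
by rewrite (leq_trans _ cW) ?leq_addr.
Qed.

End ProbChain.

Section BadGraphs.
Variables (V N : finType) (EH : {set {set V}}).
Local Notation img := (img EH).
Implicit Types (X U F : {set {set N}}) (K : {set N}) (f : {ffun V -> N}).
Hypothesis card_edge : forall e, e \in EH -> #|e| = 2%N.

Definition pairs_in K : {set {set N}} := [set e : {set N} | (#|e| == 2)%N && (e \subset K)].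

Definition edge_inside K f := injectiveb f && [exists e in EH, f @: e \subset K].

Definition overlapping K (z : {ffun V -> N} * {ffun V -> N}) :=
  edge_inside K z.1 && [&& injectiveb z.2,
    [exists e0 in EH, (z.2 @: e0 \in img z.1) && ~~ (z.2 @: e0 \subset K)] &
    [exists e in EH, (z.2 @: e \subset K) && (z.2 @: e \notin img z.1)]].

(* [F] is a possible final graph of the game when [X] is the set of pairs that
   Decider is willing to add. *)
Definition bad_for K X := [exists F : {set {set N}}, [&& F \subset X, ~~ has_copy EH F,
  [forall e in F, ~~ (e \subset K)] &
  [forall e in X, (#|e| == 2)%N && (e \notin F) ==> has_copy EH (e |: F)]]].

(** A deterministic count. Every [e] in [Y] gets a copy [fe e] in [e |: F] whose only edge inside
    [K] is [e]. If the first three events fail, fewer than [m2] overlapping pairs cover at most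
    [m2 * (2 * #|EH|)] edges [Z], and fewer than [m3] copies avoid [Z]; so some edge of [Z] lies in
    more than [L] copies. *)
Lemma bad_for_events K X t L m2 m3 :
  (0 < L)%N -> (m3 + m2 * (2 * #|EH|) * L <= t)%N -> (0 < t)%N -> bad_for K X ->
  [|| (#|X :&: pairs_in K| < t)%N,
      disjoint_family (overlapping K) (fun z => img z.1 :|: img z.2) m2 X,
      disjoint_family (edge_inside K) img m3 X |
      [exists g : {set N}, (#|g| == 2)%N && chain EH L g [set g] X]].
Proof.
move=> L0 le_t t0 /existsP [F /and4P[sFX nF /forall_inP indep /forall_inP cl]].
set Y := X :&: pairs_in K; case: ltnP => //= leY.
have YP e : e \in Y -> [/\ e \in X, #|e| = 2%N & e \subset K].
  by rewrite !inE => /and3P[-> /eqP -> ->].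
have copyY e : e \in Y -> exists f, injectiveb f && (img f \subset e |: F).
  move=> eY; have [eX e2 eK] := YP e eY; apply/existsP.
  have /implyP := cl e eX; apply; rewrite e2 eqxx /=.
  by apply: contraTN eK => /indep.
(* An element of [Y] supplies the default value of [fe] outside [Y]. *)
have [e0 e0Y] : exists e, e \in Y by apply/set0Pn; rewrite -card_gt0 (leq_trans t0).
have [fe feP] : exists fe : {set N} -> {ffun V -> N}, forall e, e \in Y ->
    injectiveb (fe e) && (img (fe e) \subset e |: F).
  apply: (@fin_all_exists _ (fun=> {ffun V -> N})
    (fun e f => e \in Y -> injectiveb f && (img f \subset e |: F))) => e.
  case: (boolP (e \in Y)) => [/copyY [f Pf]|_].
    by exists f.
  by have [f _] := copyY e0 e0Y; exists f.
have injfe e : e \in Y -> injectiveb (fe e) by move/feP/andP => [].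
have subfe e : e \in Y -> img (fe e) \subset e |: F by move/feP/andP => [].
(* Without the edge [e] the copy would lie in [F], which has none. *)
have selfI e : e \in Y -> e \in img (fe e).
  move=> eY; apply: contraR nF => eI; apply/existsP; exists (fe e).
  rewrite injfe //=; apply/subsetP => g gI.
  have := subsetP (subfe e eY) g gI; rewrite !inE => /orP[/eqP gE|//].
  by move: gI; rewrite gE (negPf eI).
have onlyI e g : e \in Y -> g \in img (fe e) -> g \subset K -> g = e.
  move=> eY gI gK; have := subsetP (subfe e eY) g gI; rewrite !inE => /orP[/eqP //|gF].
  by have := indep g gF; rewrite gK.
have subX e : e \in Y -> img (fe e) \subset X.
  move=> eY; apply: subset_trans (subfe e eY) _; rewrite subUset sFX sub1set andbT.
  by have [] := YP e eY.
have insideI e : e \in Y -> edge_inside K (fe e).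
  move=> eY; rewrite /edge_inside injfe //=; have /imgP [d dE de] := selfI e eY.
  by apply/exists_inP; exists d => //; rewrite -de; have [] := YP e eY.
have feinj : {in Y &, injective fe}.
  move=> e e' eY e'Y eq; apply: (onlyI e' e) => //; last by have [] := YP e eY.
  by rewrite -eq selfI.
pose J z := img (fe z.1) :|: img (fe z.2).
pose P (A : {set {set N} * {set N}}) :=
  [forall z in A, [&& z.1 \in Y, z.2 \in Y, z.1 != z.2 &
      ~~ [disjoint img (fe z.1) & img (fe z.2)]]] &&
  [forall z in A, forall z' in A, (z != z') ==> [disjoint J z & J z']].
have P0 : P set0.
  by apply/andP; split; apply/forall_inP => z; rewrite inE.
have [A /maxsetP [PA maxA] _] := maxset_exists P0.
have /andP[/forall_inP A1 /forall_inP A2] := PA.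
pose Z := \bigcup_(z in A) J z.
case: (leqP m2 #|A|) => [leA|ltA].
  apply/orP; left; apply/existsP; exists ((fun z => (fe z.1, fe z.2)) @: A).
  apply/and3P; split.
  - rewrite card_in_imset // => -[a b] [a' b'] /A1 /= /and4P[aY bY _ _].
    move=> /A1 /= /and4P[aY' bY' _ _] [ea eb].
    by rewrite (feinj a a') // (feinj b b').
  - apply/forall_inP => _ /imsetP [[a b] /A1 /= /and4P[aY bY ab nd] ->] /=.
    rewrite subUset !subX // /overlapping /= insideI // injfe //= andbT.
    apply/andP; split; apply/exists_inP.
      case/pred0Pn: nd => g /andP[/= ga /imgP [d dE gd]]; exists d => //.
      rewrite -gd ga; apply: contra ab => gK.
      by rewrite -(onlyI a g) // -(onlyI b g) // gd img_edge.
    have /imgP [d dE bd] := selfI b bY; have [_ _ bK] := YP b bY.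
    exists d; rewrite -?bd ?bK //=; apply: contra ab => bI.
    by rewrite (onlyI a b).
  apply/forall_inP => _ /imsetP [z zA ->]; apply/forall_inP => _ /imsetP [z' zA' ->].
  apply/implyP => ne; have /forall_inP /(_ z' zA') /implyP := A2 z zA; apply.
  by apply: contra ne => /eqP ->.
pose Y' := [set e in Y | [disjoint img (fe e) & Z]].
have inY' e : (e \in Y') = (e \in Y) && [disjoint img (fe e) & Z] by rewrite in_set.
(* Two overlapping copies that both avoid [Z] could be added to [A], against maximality. *)
have disjY' e e' : e \in Y' -> e' \in Y' -> e != e' ->
    [disjoint img (fe e) & img (fe e')].
  rewrite !inY' => /andP[eY eZ] /andP[e'Y e'Z] ne; apply: contraT => nd.
  have JZ : [disjoint J (e, e') & Z].
    apply/pred0P => g /=; rewrite !inE /=; apply/negP => /andP[/orP[gI|gI] gZ].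
      by rewrite (disjointFr eZ gI) in gZ.
    by rewrite (disjointFr e'Z gI) in gZ.
  have sJ z : z \in A -> [disjoint J (e, e') & J z].
    by move=> zA; apply: disjointWr JZ; apply: (bigcup_sup z).
  have PA' : P ((e, e') |: A).
    apply/andP; split; apply/forall_inP => z /setU1P [->|zA].
    - by rewrite /= eY e'Y ne nd.
    - exact: A1.
    - apply/forall_inP => z' /setU1P [->|zA']; first by rewrite eqxx.
      by apply/implyP => _; apply: sJ.
    - apply/forall_inP => z' /setU1P [->|zA'].
        by apply/implyP => _; rewrite disjoint_sym; apply: sJ.
      by have /forall_inP := A2 z zA; apply.
  have eA : (e, e') \in A by rewrite -(maxA _ PA' (subsetUr _ _)) setU11.
  have := disjointFr eZ (selfI e eY).
  by rewrite (subsetP (bigcup_sup (e, e') eA)) // !inE selfI.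
case: (leqP m3 #|Y'|) => [leY'|ltY'].
  apply/orP; right; apply/orP; left; apply/existsP; exists (fe @: Y').
  have sY' e : e \in Y' -> e \in Y by rewrite inY' => /andP[].
  apply/and3P; split.
  - by rewrite card_in_imset // => e e' /sY' eY /sY' e'Y; apply: feinj.
  - by apply/forall_inP => _ /imsetP [e /sY' eY ->]; rewrite insideI //= subX.
  - apply/forall_inP => _ /imsetP [e eY ->]; apply/forall_inP => _ /imsetP [e' eY' ->].
    by apply/implyP => ne; apply: disjY' => //; apply: contra ne => /eqP ->.
apply/orP; right; apply/orP; right.
pose S g := [set e in Y | g \in img (fe e)].
have inS g e : (e \in S g) = (e \in Y) && (g \in img (fe e)) by rewrite in_set.
(* Otherwise [Y], covered by [Y'] and the sets [S g] with [g] in [Z], would have fewer than [t]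
   elements. *)
have [g gZ ltS] : exists2 g, g \in Z & (L < #|S g|)%N.
  apply/exists_inP; apply: contraTT leY => /exists_inPn Sle; rewrite -ltnNge.
  apply: leq_trans le_t.
  have cZ : (#|Z| <= #|A| * (2 * #|EH|))%N.
    apply: card_bigcup_le => z /A1 /and4P[z1 z2 _ _].
    by rewrite /J cardsU (leq_trans (leq_subr _ _)) // !card_img ?injfe // mul2n addnn.
  have /subset_leq_card : Y \subset Y' :|: \bigcup_(g in Z) S g.
    apply/subsetP => e eY; rewrite inE; case: (boolP (e \in Y')) => //=.
    rewrite inY' eY /= => /pred0Pn [g /andP[/= gI gZ]].
    by apply/bigcupP; exists g => //; rewrite inS eY.
  have cS : (#|\bigcup_(g in Z) S g| <= #|Z| * L)%N.
    by apply: card_bigcup_le => g gZ; rewrite leqNgt Sle.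
  rewrite cardsU => le1.
  have le2 : (#|Z| * L <= m2 * (2 * #|EH|) * L)%N.
    by rewrite leq_mul2r (leq_trans cZ) ?orbT // leq_mul2r ltnW ?orbT.
  apply: leq_ltn_trans le1 (leq_ltn_trans (leq_subr _ _) _).
  by rewrite -addSn leq_add // (leq_trans cS).
apply/existsP; exists g.
have [e eS] : exists e, e \in S g by apply/set0Pn; rewrite -card_gt0 (leq_trans _ ltS).
have /imgP [d dE gd] : g \in img (fe e) by move: eS; rewrite inS => /andP[].
have eY : e \in Y by move: eS; rewrite inS => /andP[].
have -> : #|g| = 2%N.
  by rewrite gd card_imset ?card_edge //; apply/injectiveP/injfe.
(* If [g] were inside [K], only the copy belonging to [g] itself could contain it. Hence [g] is none
   of the own edges in the chain. *)
have gK : ~~ (g \subset K).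
  apply: contraTN ltS => gK; rewrite -leqNgt (leq_trans _ L0) //.
  rewrite -(cards1 g); apply/subset_leq_card/subsetP => e'.
  by rewrite inS inE => /andP[e'Y gI]; rewrite (onlyI e' g).
have sz : size (take L (enum (S g))) = L.
  by rewrite size_take -cardE ltS.
have inSt e' : e' \in take L (enum (S g)) -> (e' \in Y) && (g \in img (fe e')).
  by move/mem_take; rewrite mem_enum inS.
rewrite eqxx -[L in chain _ L]sz.
apply: (chain_of_family (fe := fe) (K := K)) => [|e'|e' e''|e'].
- by rewrite take_uniq ?enum_uniq.
- move/inSt/andP => [e'Y ge']; have [_ _ e'K] := YP e' e'Y.
  by split; rewrite ?injfe ?selfI ?subX.
- by move/inSt/andP => [e'Y ge'] e''I e''K; apply: onlyI e'Y _ _.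
- move/inSt/andP => [e'Y ge']; rewrite inE; apply: contra gK => /eqP <-.
  by have [] := YP e' e'Y.
Qed.

End BadGraphs.

(** * The game against a random Decider *)

Section GraphOnItsVertices.
Variables (T : finType) (H : graph T).

(** On the type of the vertices of [H] copies are injective everywhere, so that the counting above
    applies. *)
Definition vertex : finType := {x : T | x \in verts H}.
Definition vedges : {set {set vertex}} :=
  [set [set x : vertex | val x \in e] | e : {set T} in edges H].

Lemma edge_of_graph e : e \in edges H -> (e \subset verts H) && (#|e| == 2)%N.
Proof. by case: H => G isG; apply: (forall_inP isG). Qed.

Lemma val_edge (e : {set T}) : e \subset verts H ->
  val @: [set x : vertex | val x \in e] = e.
Proof.
move=> eH; apply/setP => t; apply/imsetP/idP => [[x]|te].
  by rewrite inE => xe ->.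
by exists (Sub t (subsetP eH t te)); rewrite ?inE SubK.
Qed.

Lemma card_vertex : #|{: vertex}| = #|verts H|.
Proof. by rewrite card_sig; apply: eq_card. Qed.

Lemma card_vedge e : e \in vedges -> #|e| = 2%N.
Proof.
case/imsetP => d /edge_of_graph /andP[dH /eqP d2] ->.
by rewrite -(card_imset _ val_inj) val_edge.
Qed.

Lemma card_vedges : #|vedges| = #|edges H|.
Proof.
apply: card_in_imset => d d' /edge_of_graph /andP[dH _] /edge_of_graph /andP[d'H _] eq.
by rewrite -(val_edge dH) -(val_edge d'H) eq.
Qed.

Lemma contains_copyE n (F : {set {set 'I_n}}) : verts H != set0 ->
  contains_copy H F = has_copy vedges F.
Proof.
case/set0Pn => t0 t0H; pose x0 : vertex := Sub t0 t0H.
apply/existsP/existsP => -[].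
  move=> f /andP[/dinjectiveP injf /forall_inP sub]; exists [ffun x : vertex => f (val x)].
  apply/andP; split.
    apply/injectiveP => x y; rewrite !ffunE => eq.
    by apply: val_inj; apply: injf eq; apply: valP.
  apply/subsetP => _ /imgP [_ /imsetP [e eH ->] ->].
  have /andP[eV _] := edge_of_graph eH.
  rewrite (_ : _ @: _ = f @: e) ?sub // -[in RHS](val_edge eV) -imset_comp.
  by apply: eq_imset => x; rewrite ffunE.
move=> g /andP[/injectiveP injg /subsetP sub].
(* Points outside [verts H] go to the image of the default vertex [x0]; no condition concerns
   them. *)
exists [ffun t => g (insubd x0 t)]; apply/andP; split.
  apply/dinjectiveP => t u tH uH; rewrite !ffunE => /injg /(congr1 val).
  by rewrite !insubdK.
apply/forall_inP => e eH; have /andP[eV _] := edge_of_graph eH.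
apply: sub; apply/imgP; exists [set x : vertex | val x \in e]; first exact: imset_f.
rewrite -[in LHS](val_edge eV) -imset_comp.
by apply: eq_imset => x; rewrite /= ffunE valKd.
Qed.

End GraphOnItsVertices.

Section Game.
Variables (R : realType) (T : finType) (H : graph T) (n k k' : nat) (p : R).
Variable s : history n -> {set 'I_n} -> R.
Hypothesis le_k : (k <= k')%N.
Hypotheses (H_nonempty : verts H != set0) (s_strategy : proposer_strategy H s).
Hypothesis p01 : 0 <= p <= 1.

Definition bad (G : {set {set 'I_n}}) :=
  [exists K : {set 'I_n}, (#|K| == k)%N && bad_for (vedges H) K G].

(* The graph of the pairs already added and of those that Decider would still
   add, if his decision on the pair [e] is read off from [e \in X]. *)
Definition potential (h : history n) X := current h :|: (X :\: proposed h).

Lemma current_true (h : history n) e : current ((e, true) :: h) = e |: current h.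
Proof. by apply/setP => d; rewrite !inE xpair_eqE andbT. Qed.

Lemma current_false (h : history n) e : current ((e, false) :: h) = current h.
Proof. by apply/setP => d; rewrite !inE xpair_eqE andbF. Qed.

Lemma proposed_cons (h : history n) e b : proposed ((e, b) :: h) = e |: proposed h.
Proof. by apply/setP => d; rewrite !inE. Qed.

Lemma potential_true h e X : e \notin proposed h ->
  potential ((e, true) :: h) X = potential h (e |: X).
Proof.
move=> eh; rewrite /potential current_true proposed_cons; apply/setP => d.
rewrite !inE; have [->|_] := eqVneq d e => //=.
by move: eh; rewrite inE => /negPf ->; rewrite orbT.
Qed.

Lemma potential_false h e X :
  potential ((e, false) :: h) X = potential h (X :\ e).
Proof.
rewrite /potential current_false proposed_cons; apply/setP => d; rewrite !inE.
by have [->|_] := eqVneq d e => /=; rewrite ?andbF.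
Qed.

(** [K] is a subset of size [k] of the independent set, and the current graph serves as [F]. A pair
    of the potential graph outside it has not been proposed, so at the end of the game it can be
    illegal only by closing a copy. *)
Lemma bad_of_game_over h X : ~~ contains_copy H (current h) -> game_over H h ->
  has_independent_set k' (current h) -> bad (potential h X).
Proof.
move=> nocopy over /existsP [S /andP[/eqP cS /forall_inP indepS]].
have /card_geqP [t [ut st tS]] : (k <= #|S|)%N by rewrite cS.
pose K := [set x in t]; have cK : #|K| == k by rewrite cardsE (card_uniqP ut) st.
have indep : [forall e in current h, ~~ (e \subset K)].
  apply/forall_inP => e /indepS; apply: contra => eK; apply: subset_trans eK _.
  by apply/subsetP => x; rewrite inE => /tS.
apply/existsP; exists K; rewrite cK; apply/existsP; exists (current h).
rewrite subsetUl -contains_copyE // nocopy indep /=; apply/forall_inP => e.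
rewrite inE => eG; apply/implyP => /andP[e2 eh]; move: eG.
rewrite (negPf eh) inE => /andP[eP _]; rewrite -contains_copyE //.
by move/existsPn/(_ e): over; rewrite /legal e2 eh eP negbK.
Qed.

(** Decider's decision on the proposed pair [e] is replaced by the membership of [e] in [X], which
    is still undetermined as [e] is new. The bound holds for every legal proposal, hence for any
    mixture of them. *)
Lemma prob_from_le m (h : history n) :
  uniq (map fst h) -> (forall e, e \in map fst h -> #|e| = 2%N) ->
  (size h + m = 'C(n, 2))%N -> ~~ contains_copy H (current h) ->
  prob_from H s (fun=> p) (has_independent_set k') m h <=
  expect p (fun X => (bad (potential h X))%:R).
Proof.
have final h' : ~~ contains_copy H (current h') -> game_over H h' ->
    (has_independent_set k' (current h'))%:R <=
    expect p (fun X => (bad (potential h' X))%:R).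
  move=> nocopy over; apply: expect_ge => // X; rewrite ler_nat.
  by case: (boolP (has_independent_set _ _)) => // /bad_of_game_over ->.
elim: m h => [|m IH] h uh h2 sz nocopy /=.
  (* No turn remains: all ['C(n, 2)] pairs have been proposed, so the game is over. *)
  apply: final => //; apply/existsPn => e; apply/negP => /and4P[/eqP e2 _ eP _].
  move: eP; suff -> : proposed h = [set e : {set 'I_n} | (#|e| == 2)%N].
    by rewrite inE e2.
  apply/eqP; rewrite eqEcard card_draws card_ord -sz addn0; apply/andP; split.
    by apply/subsetP => d; rewrite !inE => /h2 ->.
  rewrite -(size_map fst) -(card_uniqP uh); apply: subset_leq_card.
  by apply/subsetP => d; rewrite inE.
case: ifP => [over|/negbT over]; first exact: final.
have [s0 s_illegal s1] := s_strategy over.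
rewrite -[leRHS]mul1r -[X in _ <= X * _]s1 mulr_suml; apply: ler_sum => e _.
have [leg|/s_illegal ->] := boolP (legal H h e); last by rewrite !mul0r.
rewrite ler_wpM2l //; have /and4P[/eqP e2 _ eP noc] := leg.
have [p0 p1] := andP p01.
have IHe b : ~~ contains_copy H (current ((e, b) :: h)) ->
    prob_from H s (fun=> p) (has_independent_set k') m ((e, b) :: h) <=
    expect p (fun X => (bad (potential ((e, b) :: h) X))%:R).
  apply: IH => /=.
  - by rewrite uh andbT; move: eP; rewrite inE.
  - by move=> d; rewrite inE => /orP[/eqP -> //|/h2].
  - by rewrite addSnnS.
(* Acceptance and refusal correspond to forcing [e] into [X] and out of [X]. *)
rewrite (expect_resample p e) lerD ?ler_wpM2l ?subr_ge0 //.
  rewrite (le_trans (IHe true _)) ?current_true //.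
  by apply: expect_le => // X; rewrite potential_true.
rewrite (le_trans (IHe false _)) ?current_false //.
by apply: expect_le => // X; rewrite potential_false.
Qed.

Lemma prob_final_le : edges H != set0 ->
  prob_final H s (fun=> p) (has_independent_set k') <= prob p bad.
Proof.
move=> edgesH; apply: le_trans (prob_from_le _ _ _ _) _ => //.
  have cur0 : current ([::] : history n) = set0 by apply/setP => e; rewrite !inE.
  case/set0Pn: edgesH => e eH; apply/existsP => -[f /andP[_ /forall_inP /(_ e eH)]].
  by rewrite cur0 inE.
apply: expect_le => // X; rewrite (_ : potential _ _ = X) //.
by apply/setP => e; rewrite !inE.
Qed.

End Game.

(** * Density of strictly 2-balanced graphs *)

(** If a subgraph with [x] vertices and [y] edges is less dense than the whole graph with [z] and
    [u], the rest is denser: write [z - x] as [(z - 2) - (x - 2)] and insert the cross-multiplied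
    density inequality. *)
Lemma arith_balance x y z u : (2 < x)%N -> (y < u)%N -> (x <= z)%N ->
  (y * (z - 2) < u.-1 * (x - 2) + (z - 2))%N ->
  ((z - x) * u.-1 < (u - y) * (z - 2))%N.
Proof.
case: x => [|[|x]] //; case: u => [//|u] /= _ le_yu le_xz.
rewrite -(subnK le_xz) addnK; rewrite !subn2 !addnS /= ltnS in le_yu *.
by rewrite -(subnK le_yu) -addSn addnK; nia.
Qed.

Section BalancedDensity.
Variables (T : finType) (H : graph T).
Local Notation v := #|verts H|.
Local Notation E := #|edges H|.
Hypotheses (H_nonempty : verts H != set0) (H_bal : strictly_2balanced H).

Lemma subgraph_refl (F : graph T) : subgraph F F.
Proof. by rewrite /subgraph !subxx. Qed.

Lemma density2_le_m2 (F : graph T) : density2 F <= m2 F.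
Proof. exact/le_bigmax_cond/subgraph_refl. Qed.

Lemma empty_is_graph : is_graph (set0 : {set T}, set0 : {set {set T}}).
Proof. by apply/forall_inP => e; rewrite inE. Qed.

Lemma m2_gt0 : 0 < m2 H.
Proof.
apply: le_lt_trans (H_bal (F := Graph empty_is_graph) _); first exact: bigmax_ge_id.
rewrite /proper_subgraph /subgraph !sub0set /=.
by apply: contra H_nonempty => /eqP <-.
Qed.

(** The maximum is attained at [H]: a proper subgraph has [density2 F <= m2 F < m2 H]. *)
Lemma m2E : m2 H = density2 H.
Proof.
apply/eqP; rewrite eq_le density2_le_m2 andbT leNgt; apply/negP => lt.
have := ltxx (m2 H); rewrite {1}/m2 bigmax_lt ?m2_gt0 // => F sub.
have [->//|FH] := eqVneq F H.
by apply: le_lt_trans (density2_le_m2 F) _; apply: H_bal; rewrite /proper_subgraph sub.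
Qed.

Lemma density2_large (F : graph T) : (2 < #|verts F|)%N ->
  density2 F = (#|edges F|%:R - 1) / (#|verts F|%:R - 2).
Proof.
by move=> v2; rewrite /density2 v2 /is_K2 (gtn_eqF v2) /= !mul1r mul0r addr0.
Qed.

Lemma dense_card_verts : 1 < m2 H -> (2 < v)%N.
Proof.
rewrite m2E /density2; case: (ltnP 2 v) => // _; rewrite mul0r add0r.
by case: (is_K2 H); rewrite ?mul1r ?mul0r.
Qed.

Lemma m2_dense : 1 < m2 H -> m2 H = E.-1%:R / (v - 2)%:R.
Proof.
move=> m1; have v2 := dense_card_verts m1.
have E0 : (0 < E)%N.
  rewrite lt0n; apply: contraTneq m1 => E0.
  rewrite m2E density2_large // E0 sub0r -leNgt mulN1r.
  by rewrite (@le_trans _ _ 0) // oppr_le0 invr_ge0 subr_ge0 ler_nat ltnW.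
by rewrite m2E density2_large // natrB ?(ltnW v2) // -subn1 natrB.
Qed.

Lemma dense_card_edges : 1 < m2 H -> (v - 2 < E.-1)%N.
Proof.
move=> m1; have v2 := dense_card_verts m1; move: (m1); rewrite m2_dense //.
by rewrite ltr_pdivlMr ?ltr0n ?subn_gt0 // mul1r ltr_nat.
Qed.

(** The subgraph with vertices [A] and edges [D] is proper because an edge is missing, even when [A]
    contains all vertices. *)
Lemma balanced_vedges (A : {set vertex H}) (D : {set {set vertex H}}) :
  1 < m2 H -> D \subset vedges H -> D != vedges H ->
  (forall e, e \in D -> e \subset A) -> (2 < #|A|)%N ->
  ((#|{: vertex H}| - #|A|) * #|vedges H|.-1 <
   (#|vedges H| - #|D|) * (#|{: vertex H}| - 2))%N.
Proof.
move=> m1 sD nD DA A2; rewrite card_vertex card_vedges.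
pose FV : {set T} := val @: A; pose FE : {set {set T}} := (fun e : {set vertex H} => val @: e) @: D.
have isF : is_graph (FV, FE).
  apply/forall_inP => _ /imsetP [e eD ->] /=; rewrite imsetS ?DA //.
  by rewrite card_imset ?(card_vedge (subsetP sD e eD)) //; apply: val_inj.
have cV : #|FV| = #|A| by rewrite card_imset //; apply: val_inj.
have cE : #|FE| = #|D| by rewrite card_imset //; apply: imset_inj; apply: val_inj.
have subD e : e \in D -> val @: e \in edges H.
  move/(subsetP sD)/imsetP => [d dH ->]; rewrite val_edge //.
  by have /andP[] := edge_of_graph dH.
have ltD : (#|D| < E)%N.
  by rewrite -(card_vedges H) ltnNge; apply: contra nD => le; rewrite eqEcard sD.
have leA : (#|A| <= v)%N by rewrite -card_vertex max_card.
have proper : proper_subgraph (Graph isF) H.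
  apply/andP; split; first (apply/andP; split => /=).
  - by apply/subsetP => _ /imsetP [x _ ->]; apply: valP.
  - by apply/subsetP => _ /imsetP [e eD ->]; apply: subD.
  apply/eqP => /(congr1 (fun F : graph T => #|edges F|)) /= FH.
  by move: ltD; rewrite -FH cE ltnn.
have := le_lt_trans (density2_le_m2 _) (H_bal proper).
rewrite m2_dense // density2_large /= ?cV ?cE // => lt; move: lt.
have v2 := dense_card_verts m1.
rewrite ltr_pdivrMr ?subr_gt0 ?ltr_nat // mulrAC ltr_pdivlMr ?ltr0n ?subn_gt0 //.
have -> : #|A|%:R - 2 = (#|A| - 2)%:R :> rat by rewrite natrB // ltnW.
rewrite mulrBl mul1r ltrBlDr -!natrM -natrD ltr_nat.
exact: arith_balance.
Qed.

End BalancedDensity.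

(** * Probability of a bad graph *)

From mathcomp Require Import all_classical all_reals all_analysis.

Import numFieldNormedType.Exports.

(** * Exponential forms of the tail bounds *)

Section ExpBounds.
Variable (R : realType).

Lemma prod_1D_le_expR (I : finType) (Q : pred I) (u : I -> R) :
  (forall i, 0 <= u i) -> \prod_(i | Q i) (1 + u i) <= expR (\sum_(i | Q i) u i).
Proof.
move=> u0; rewrite expR_sum; apply: ler_prod => i _.
by rewrite addr_ge0 //= expR_ge1Dx.
Qed.

Lemma expR1_le4 : expR 1 <= 4 :> R.
Proof.
have h : expR (- (1 / 2)) >= 1 / 2 :> R by apply: le_trans (expR_ge1Dx _); lra.
have -> : expR 1 = expR (1 / 2) * expR (1 / 2) :> R.
  by rewrite -expRD; congr expR; lra.
have e0 := expR_gt0 (1 / 2 : R).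
have e2 : expR (1 / 2) * (1 / 2) <= 1 :> R.
  by rewrite -ler_pdivlMl // mulr1 -expRN.
by move: (expR _) e0 e2 => y y0 y2; nra.
Qed.

Lemma exprn_le_expR (x y : R) m : 0 <= x -> x <= expR y -> x ^+ m <= expR (m%:R * y).
Proof.
by move=> x0 xy; rewrite expRM_natl lerXn2r ?nnegrE ?expR_ge0.
Qed.

Variables (U : finType) (p : R).
Hypothesis p01 : 0 <= p <= 1.

Lemma prob_disjoint_family_expR (I : finType) (Q : pred I) (F : I -> {set U})
    (m : nat) (s mu : R) : 0 <= s -> \sum_(i | Q i) p ^+ #|F i| <= mu ->
  prob p (disjoint_family Q F m)
  <= expR (expR s * mu - s * m%:R).
Proof.
move=> s0 le_mu; have p0 : 0 <= p by case/andP: p01.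
have x1 : 1 <= expR s by rewrite -expR0 ler_expR.
apply: le_trans (prob_disjoint_family p01 Q F m x1) _.
rewrite expRD mulrC -mulNr -[_ * m%:R]mulrC expRM_natl expRN -exprVn.
rewrite ler_wpM2r ?exprn_ge0 ?invr_ge0 ?expR_ge0 //.
apply: le_trans (prod_1D_le_expR _ _) _ => [i|].
  by rewrite mulr_ge0 ?expR_ge0 ?exprn_ge0.
by rewrite ler_expR -mulr_sumr ler_wpM2l ?expR_ge0.
Qed.

(** The lower tail at [y = 1/e], where [1 - y >= 1/2] gives a factor [expR (- (p / 2))] per
    element. *)
Lemma prob_card_lt_expR (B : {set U}) (t : nat) :
  prob p (fun X => #|X :&: B| < t)%N <= expR (t%:R - p * #|B|%:R / 2).
Proof.
have [p0 p1] := andP p01.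
have e0 := expR_gt0 (1 : R).
have y0 : 0 < (expR 1)^-1 :> R by rewrite invr_gt0.
have y1 : (expR 1)^-1 <= 1 / 2 :> R.
  rewrite div1r lef_pV2 ?posrE //; apply: le_trans (expR_ge1Dx _); lra.
apply: le_trans (prob_card_lt p01 B t (y := (expR 1)^-1) _) _.
  by rewrite y0 (le_trans y1) //; lra.
rewrite expRD exprVn invrK -expRM_natl mulr1 ler_wpM2l ?expR_ge0 //.
apply: le_trans (exprn_le_expR (y := - (p / 2)) _ _ _) _.
- by rewrite subr_ge0 mulr_ile1 //; lra.
- apply: le_trans (expR_ge1Dx _); nra.
by rewrite le_eqVlt; apply/orP; left; apply/eqP; congr expR; lra.
Qed.

End ExpBounds.

(** * Numerical inequalities between the constants *)

Section Arithmetic.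
Variable F : realFieldType.
Implicit Types b c d e G h k l p q v x y : F.

Lemma arith_k_gt1 G l h : 10 <= G -> 2 <= l -> 32 * G * l <= h -> 1 < h.
Proof. nra. Qed.

Lemma arith_c e d : e != 0 -> d != 0 -> (24 * e * d)^-1 * 24 * e * d = 1.
Proof. by move=> e0 d0; field; rewrite e0 d0. Qed.

Lemma arith_mu c e d k l : c * 24 * e * d = 1 ->
  k * (e * c) * (2 * (d * l)) = k * l / 12.
Proof.
move=> eq1; transitivity ((c * 24 * e * d) * (k * l / 12)); first by field.
by rewrite eq1 mul1r.
Qed.

Lemma arith_few p b k l G : p * k ^+ 2 <= p * (4 * b) ->
  k * (32 * G * l) <= k * (k * p) -> 0 <= k * l * (G - 10) -> 0 <= k * l ->
  k * l * (2 * G) - p * b / 2 <= - (3 * k * l).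
Proof. lra. Qed.

Lemma arith_single h k l G : h <= 4 * (k * l / 12) ->
  0 <= k * l * (G - 10) -> 0 <= k * l -> h - k * l * G <= - (3 * k * l).
Proof. lra. Qed.

Lemma arith_exponent l e k : 2 <= e -> l / (2 * e) * (8 * e * k) = 4 * k * l.
Proof. by move=> e2; field; apply: lt0r_neq0; lra. Qed.

Lemma arith_eta e v q d l y : q * y * 1 <= q * y * l ->
  4 * e * v * (q * (2 * (d * l))) + q * y <= (8 * e * v * d + y) * l * q.
Proof. lra. Qed.

Lemma arith_overlap h k l : h <= k / 12 -> k * 2 <= k * l -> 0 <= k ->
  h - 4 * k * l <= - (3 * k * l).
Proof. lra. Qed.

Lemma arith_chain c e d x : c * 24 * e * d = 1 ->
  4 * e * c * 1 <= 4 * e * c * (d / 2) -> x <= 1 / 6 -> 4 * e * c + x <= 1 / 4.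
Proof. lra. Qed.

Lemma arith_union k l : 0 <= l -> 2 * l <= k * l -> k * l - 3 * k * l <= - (2 * l).
Proof. lra. Qed.

Lemma arith_pairs l : 2 * l - 4 * l <= - (2 * l).
Proof. lra. Qed.

Lemma arith_large G d : 10 <= G -> d = 32 * G -> 1 <= d / 2.
Proof. by move=> ? ->; lra. Qed.

End Arithmetic.

Lemma arith_G n : (1 < n)%N -> (10 <= (8 * n) ^ 2)%N. Proof. nia. Qed.

Lemma arith_bin2 k b : (1 < k)%N -> (b * 2 = k * k.-1)%N -> (k ^ 2 <= 4 * b)%N.
Proof. case: k => [//|k] /=; nia. Qed.

(** With [n] edges in the graph, [8 * n * k] overlapping pairs of [2 * n] edges each, with [4 * lam]
    copies through every edge, account for [64 * n ^ 2 * k * lam] copies, exactly as many as are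
    allowed to be single. *)
Lemma arith_budget k lam n :
  (k * lam * (8 * n) ^ 2 + 8 * n * k * (2 * n) * (4 * lam) = k * lam * (2 * (8 * n) ^ 2))%N.
Proof. rewrite expnMn; nia. Qed.

(** * The four events with explicit constants *)

Section BadProbability.
Variables (R : realType) (V N : finType) (EH : {set {set V}}).
Variables (q c p : R) (D lam k : nat).
Local Notation v := #|V|.
Local Notation E := #|EH|.
Local Notation img := (img EH).
Local Notation a := (q ^+ E.-1).

Hypotheses (card_edge : forall e, e \in EH -> #|e| = 2%N).
Hypotheses (v_gt2 : (2 < v)%N) (E_gt1 : (1 < E)%N).
Hypothesis balanced : forall (A : {set V}) (D : {set {set V}}),
  D \subset EH -> D != EH -> (forall e, e \in D -> e \subset A) -> (2 < #|A|)%N ->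
  ((v - #|A|) * E.-1 < (E - #|D|) * (v - 2))%N.
Hypotheses (q01 : 0 < q <= 1) (c01 : 0 < c <= 1).
Hypotheses (p_def : p = c * q ^+ (v - 2)) (N_def : #|N|%:R * a = 1).

Let q0 : 0 < q. Proof. by case/andP: q01. Qed.
Let c0 : 0 < c. Proof. by case/andP: c01. Qed.
Let p0 : 0 < p. Proof. by rewrite p_def mulr_gt0 ?exprn_gt0. Qed.
Let p01 : 0 <= p <= 1.
Proof.
case/andP: q01 => _ q1; case/andP: c01 => _ c1; rewrite ltW //=.
by rewrite p_def mulr_ile1 ?exprn_ile1 ?exprn_ge0 ?(ltW q0) ?(ltW c0).
Qed.

(** The second copy is charged for its new edges only, and its sum is bounded uniformly in the first
    copy. *)
Lemma sum_overlapping (K : {set N}) :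
  \sum_(z | overlapping EH K z) p ^+ #|img z.1 :|: img z.2| <=
  E%:R * #|K|%:R ^+ 2 * p * c ^+ E.-1 *
  (4 * E%:R ^+ 2 * v%:R * c ^+ E.-1 * (#|K|%:R * a) + q * (v%:R + 1) ^+ v).
Proof.
set eta := (X in _ * X).
have eta0 : 0 <= eta.
  by rewrite addr_ge0 // !mulr_ge0 ?addr_ge0 ?exprn_ge0 ?addr_ge0 ?ler0n ?ler01 ?(ltW q0) ?(ltW c0).
pose Q2 (f1 f2 : {ffun V -> N}) := [&& injectiveb f2,
    [exists e0 in EH, (f2 @: e0 \in img f1) && ~~ (f2 @: e0 \subset K)] &
    [exists e in EH, (f2 @: e \subset K) && (f2 @: e \notin img f1)]].
have -> : \sum_(z | overlapping EH K z) p ^+ #|img z.1 :|: img z.2| =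
  \sum_(f1 | edge_inside EH K f1) \sum_(f2 | Q2 f1 f2) p ^+ #|img f1 :|: img f2|.
  by rewrite pair_big_dep.
apply: le_trans (ler_wpM2r eta0 (sum_edge_inside card_edge E_gt1 q01 c01 p_def N_def K)).
rewrite mulr_suml; apply: ler_sum => f1 /andP[injf1 _].
apply: le_trans (ler_wpM2l (exprn_ge0 _ (ltW p0)) (sum_extend_overlap card_edge
  v_gt2 balanced q01 c01 p_def N_def K injf1)).
rewrite mulr_sumr le_eqVlt; apply/orP; left; apply/eqP; apply: eq_bigr => f2 _.
rewrite -exprD -cardsUI; congr (_ ^+ _).
have -> : img f1 :&: (img f2 :\: img f1) = finset.set0.
  by apply/setP => x; rewrite !inE; case: (x \in img f1).
rewrite cards0 addn0; congr #|pred_of_set _|; apply/setP => x; rewrite !inE.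
by case: (x \in img f1).
Qed.

(* [lam] stands for [log n], and [k] is about [D lam / p]. *)
Local Notation G := ((8 * E) ^ 2)%N.
(** [D] makes the expected number [p * 'C(k, 2)] of edges inside [K] at least [8 * G * k * lam]; [c]
    makes that of copies with an edge inside [K] at most [k * lam / 12]. *)
Hypothesis D_def : D = (32 * G)%N.
Hypotheses (lam_gt1 : (1 < lam)%N) (c_def : c = (24 * E * D)%:R^-1).
Hypothesis N_le : #|N|%:R <= expR lam%:R :> R.
Hypothesis k_bounds : (D * lam)%:R <= k%:R * p <= 2 * (D * lam)%:R.
Hypothesis v_lt_E : (v - 2 < E.-1)%N.
Hypothesis q_small1 : q * (4 * v * lam + 3)%:R ^+ v <= 1 / 6.
Hypothesis q_small2 :
  (8 * E ^ 2 * v * D + (v.+1) ^ v)%:R * lam%:R ^+ 2 * q * expR (lam%:R / (2 * E)%:R) <= 1.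

Local Notation mu1 := (E%:R * k%:R ^+ 2 * p * c ^+ E.-1).

Let lamR : 2 <= lam%:R :> R. Proof. by rewrite ler_nat. Qed.
Let ER : 2 <= E%:R :> R. Proof. by rewrite ler_nat. Qed.
Let kR0 : 0 <= k%:R :> R. Proof. exact: ler0n. Qed.
Let GR : 10 <= G%:R :> R.
Proof. by rewrite ler_nat arith_G. Qed.
Let DR : D%:R = 32 * G%:R :> R. Proof. by rewrite D_def natrM. Qed.
Let E0 : E%:R != 0 :> R. Proof. by rewrite pnatr_eq0 -lt0n (ltnW E_gt1). Qed.
Let D0 : D%:R != 0 :> R.
Proof. by rewrite pnatr_eq0 D_def -lt0n muln_gt0 expn_gt0 muln_gt0 (ltnW E_gt1). Qed.
Let cE : c * 24 * E%:R * D%:R = 1.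
Proof. by rewrite c_def natrM natrM arith_c. Qed.
Let cpow : c ^+ E.-1 <= c.
Proof.
case/andP: c01 => c0' c1; have -> : E.-1 = E.-2.+1 by case: E E_gt1 => [|[]].
by rewrite exprS ler_piMr ?exprn_ile1 ?(ltW c0).
Qed.

Let k_gt1 : (1 < k)%N.
Proof.
rewrite -(ltr_nat R); have [p0' p1] := andP p01; have [lek _] := andP k_bounds.
have le1 : k%:R * p <= k%:R by rewrite ler_piMr.
by move: (le_trans lek le1); rewrite natrM DR; apply: arith_k_gt1.
Qed.

Let mu1_le : mu1 <= k%:R * lam%:R / 12.
Proof.
have [_ lek] := andP k_bounds; rewrite natrM in lek.
apply: (@le_trans _ _ (E%:R * k%:R ^+ 2 * p * c)).
  by rewrite ler_wpM2l ?cpow // !mulr_ge0 ?exprn_ge0 ?ler0n ?(ltW p0).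
have -> : E%:R * k%:R ^+ 2 * p * c = (k%:R * (E%:R * c)) * (k%:R * p) by ring.
apply: le_trans (ler_wpM2l _ lek) _; first by rewrite !mulr_ge0 ?ler0n ?(ltW c0).
by rewrite (arith_mu _ _ cE).
Qed.

(** The threshold is at most a quarter of the expectation, so the exponent is at most
    [- (2 * G * k * lam)]. *)
Let few_edges (K : {set N}) : #|K| = k ->
  prob p (fun X => #|X :&: pairs_in K| < k * lam * (2 * G))%N
  <= expR (- (3 * k%:R * lam%:R)).
Proof.
move=> cK; apply: le_trans (prob_card_lt_expR p01 _ _) _; rewrite ler_expR.
have -> : #|pairs_in K| = 'C(k, 2).
  rewrite -cK -cards_draws; apply: eq_card => e; rewrite !inE andbC //.
have : (k ^ 2 <= 4 * 'C(k, 2))%N.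
  apply: arith_bin2 => //; by rewrite [LHS](bin_ffact k 2) !ffactnS muln1.
rewrite -(ler_nat R) natrM natrX natrM natrM natrM => bin.
have [lek _] := andP k_bounds; rewrite natrM DR in lek.
have h := ler_wpM2l (ltW p0) bin; have h2 := ler_wpM2l kR0 lek.
have h3 : 0 <= k%:R * lam%:R * (G%:R - 10) :> R.
  by rewrite !mulr_ge0 ?subr_ge0 ?ler0n.
have h4 : 0 <= k%:R * lam%:R :> R by rewrite mulr_ge0 ?ler0n.
exact: arith_few h h2 h3 h4.
Qed.

Let many_single (K : {set N}) : #|K| = k ->
  prob p (disjoint_family (edge_inside EH K) img (k * lam * G))
  <= expR (- (3 * k%:R * lam%:R)).
Proof.
move=> cK; have le := sum_edge_inside card_edge E_gt1 q01 c01 p_def N_def K.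
apply: le_trans (prob_disjoint_family_expR p01 _ ler01 le) _; rewrite ler_expR cK.
have h : expR 1 * mu1 <= 4 * (k%:R * lam%:R / 12).
  apply: ler_pM => //; rewrite ?expR_ge0 ?expR1_le4 //.
  by rewrite !mulr_ge0 ?exprn_ge0 ?ler0n ?(ltW p0) ?(ltW c0).
have h3 : 0 <= k%:R * lam%:R * (G%:R - 10) :> R.
  by rewrite !mulr_ge0 ?subr_ge0 ?ler0n.
have h4 : 0 <= k%:R * lam%:R :> R by rewrite mulr_ge0 ?ler0n.
rewrite (natrM _ (k * lam)) (natrM _ k) mul1r.
exact: arith_single h h3 h4.
Qed.

(** The threshold has no logarithm, so the exponential moment is taken at [s = lam / (2 * E)], and
    [s] times the threshold is [4 * k * lam]. The factor [expR s], about [n ^ (1 / (2 * E))], is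
    absorbed by the powers of [q] in [eta]. *)
Let many_overlapping (K : {set N}) : #|K| = k ->
  prob p (disjoint_family (overlapping EH K) (fun z => img z.1 :|: img z.2) (8 * E * k))
  <= expR (- (3 * k%:R * lam%:R)).
Proof.
move=> cK; have := sum_overlapping K; rewrite cK; set eta := (X in _ * X) => le.
have s0 : 0 <= lam%:R / (2 * E)%:R :> R by rewrite divr_ge0 ?ler0n.
apply: le_trans (prob_disjoint_family_expR p01 _ s0 le) _; rewrite ler_expR.
set s := expR _.
have sm : lam%:R / (2 * E)%:R * (8 * E * k)%:R = 4 * k%:R * lam%:R :> R.
  by rewrite !natrM arith_exponent.
have eta_le : lam%:R * eta * s <= 1.
  apply: le_trans q_small2; rewrite ler_wpM2r ?expR_ge0 //.
  have -> : forall z : R, z * lam%:R ^+ 2 * q = lam%:R * (z * lam%:R * q) by move=> z; ring.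
  rewrite ler_wpM2l ?ler0n //.
  (* [a = 1 / n] is at most [q ^+ (v - 1)] because [v - 2 < E - 1], and [k * p] is only
     logarithmic. *)
  have ka : c ^+ E.-1 * (k%:R * a) <= q * (2 * (D * lam)%:R).
    have [_ lek] := andP k_bounds.
    apply: (@le_trans _ _ (q * (k%:R * p))); last by rewrite ler_wpM2l ?(ltW q0).
    have -> : q * (k%:R * p) = c * (k%:R * q ^+ (v - 2).+1) by rewrite p_def exprS; ring.
    have [_ q1] := andP q01.
    apply: ler_pM; rewrite ?mulr_ge0 ?exprn_ge0 ?ler0n ?(ltW q0) ?(ltW c0) //.
    by rewrite ler_wpM2l ?ler0n // ler_wiXn2l ?(ltW q0).
  rewrite /eta -[_ * c ^+ _ * _]mulrA.
  apply: (@le_trans _ _ (4 * E%:R ^+ 2 * v%:R * (q * (2 * (D * lam)%:R)) +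
                         q * (v%:R + 1) ^+ v)).
    by rewrite lerD2r ler_wpM2l ?mulr_ge0 ?exprn_ge0 ?ler0n.
  have -> : (8 * E ^ 2 * v * D + v.+1 ^ v)%:R =
            8 * E%:R ^+ 2 * v%:R * D%:R + (v%:R + 1) ^+ v :> R.
    by rewrite natrD natrX -natr1 3!natrM natrX.
  rewrite [(D * lam)%:R]natrM; apply: arith_eta; rewrite ler_wpM2l //.
    by rewrite mulr_ge0 ?exprn_ge0 ?addr_ge0 ?ler0n ?ler01 ?(ltW q0).
  by rewrite ler1n ltnW.
have eta0 : 0 <= eta.
  by rewrite addr_ge0 // !mulr_ge0 ?addr_ge0 ?exprn_ge0 ?addr_ge0 ?ler0n ?ler01 ?(ltW q0) ?(ltW c0).
have h : s * (mu1 * eta) <= k%:R / 12.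
  have -> : s * (mu1 * eta) = mu1 * (eta * s) by rewrite mulrC mulrA.
  apply: le_trans (ler_wpM2r _ mu1_le) _; first by rewrite mulr_ge0 ?expR_ge0.
  have -> : k%:R * lam%:R / 12 * (eta * s) = k%:R / 12 * (lam%:R * eta * s) by ring.
  by rewrite ler_piMr // divr_ge0.
have kl : k%:R * 2 <= k%:R * lam%:R :> R by rewrite ler_wpM2l.
by rewrite sm; apply: arith_overlap.
Qed.

(** Each further copy costs a factor [B <= 1/4 <= 1/e], so the bound for length [4 * lam] outweighs
    the [n ^ 2 <= expR (2 * lam)] choices of [g]. *)
Let long_chain (g : {set N}) : #|g| = 2%N ->
  prob p (chain EH (4 * lam) g [set g]) <= expR (- (4 * lam%:R)).
Proof.
(* The two vertices of [g] and at most [v] new ones for each copy. *)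
move=> g2; have [w w_def] : exists w, w = (2 + v * (4 * lam))%N by eexists.
pose B := 4 * E%:R * c ^+ E.-1 + q * (w%:R + 1) ^+ v.
have B0 : 0 <= B.
  apply: addr_ge0; first by rewrite !mulr_ge0 ?exprn_ge0 ?ler0n ?(ltW c0).
  by rewrite natr1 mulr_ge0 ?exprn_ge0 ?ler0n ?(ltW q0).
have ext g' (U : {set {set N}}) (W : {set N}) :
    g' \in U -> #|g'| = 2%N -> (forall g'', g'' \in U -> g'' \subset W) ->
    (#|W| <= w)%N ->
    \sum_(f : {ffun V -> N} | [&& injectiveb f, g' \in img f & ~~ (img f \subset U)])
      p ^+ #|img f :\: U| <= B.
  move=> g'U g'2 UW cW.
  apply: le_trans (sum_extend_edge card_edge v_gt2 balanced q01 c01 p_def N_def g'U g'2 UW) _.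
  rewrite lerD2l ler_wpM2l ?(ltW q0) // lerXn2r ?nnegrE ?addr_ge0 ?ler0n ?ler01 //.
  by rewrite lerD2r ler_nat.
have gW g' : g' \in [set g] -> g' \subset g by rewrite inE => /eqP ->.
have := prob_chain p01 ext (set11 g) g2 gW (L := 4 * lam) _ (finset.sub0set _) B0.
rewrite g2 w_def leqnn cards0 mul1r => /(_ isT) le.
apply: le_trans (le_trans _ le) _.
  by apply: prob_le => // X ->; rewrite finset.sub0set.
apply: le_trans (exprn_le_expR (y := -1) _ B0 _) _; last first.
  by rewrite ler_expR natrM mulrN1.
have e4 := expR1_le4 R; have e0 := expR_gt0 (1 : R).
apply: (@le_trans _ _ (1 / 4)); last first.
  by rewrite expRN div1r lef_pV2 ?posrE.
have wE : w%:R + 1 = (4 * v * lam + 3)%:R :> R.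
  by rewrite natr1 w_def; congr _%:R; rewrite mulnCA mulnA -addSn addnC.
have h : 4 * E%:R * c * 1 <= 4 * E%:R * c * (D%:R / 2).
  by rewrite ler_wpM2l ?(arith_large GR DR) // !mulr_ge0 ?ler0n ?(ltW c0).
apply: le_trans (arith_chain cE h q_small1); rewrite /B wE lerD2r.
by rewrite ler_wpM2l ?cpow // mulr_ge0 ?ler0n.
Qed.

(** Three events are summed over at most [n ^ k <= expR (k * lam)] sets [K]. Chains do not depend on
    [K] and are summed over the pairs [g] only; their bound is too weak for a sum over [K]. *)
Lemma prob_bad_le :
  prob p (fun X => [exists K : {set N}, (#|K| == k)%N && bad_for EH K X])
  <= 4 * expR (- (2 * lam%:R)).
Proof.
pose m2 := (8 * E * k)%N; pose m3 := (k * lam * G)%N.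
pose t := (k * lam * (2 * G))%N; pose L := (4 * lam)%N.
pose ev (K : {set N}) (X : {set {set N}}) := [|| (#|X :&: pairs_in K| < t)%N,
      disjoint_family (overlapping EH K) (fun z => img z.1 :|: img z.2) m2 X |
      disjoint_family (edge_inside EH K) img m3 X].
pose ch (X : {set {set N}}) := [exists g : {set N}, (#|g| == 2)%N && chain EH L g [set g] X].
apply: (@le_trans _ _ (prob p (fun X =>
    [exists K : {set N}, (#|K| == k)%N && ev K X] || ch X))).
  apply: prob_le => // X /existsP [K /andP[cK bK]].
  have L0 : (0 < L)%N by rewrite /L muln_gt0 (ltnW lam_gt1).
  have le_t : (m3 + m2 * (2 * E) * L <= t)%N.
    by rewrite /m3 /m2 /L /t arith_budget.
  have t0 : (0 < t)%N.
    by rewrite !muln_gt0 (ltnW k_gt1) (ltnW lam_gt1) (ltnW E_gt1).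
  have := bad_for_events card_edge L0 le_t t0 bK.
  case/or4P => ev1; apply/orP; [left|left|left|by right];
    by apply/existsP; exists K; rewrite cK /ev ev1 ?orbT.
apply: le_trans (prob_or_le p01 _ _) _.
have -> : 4 * expR (- (2 * lam%:R)) =
   3 * expR (- (2 * lam%:R)) + expR (- (2 * lam%:R)) :> R by ring.
have binle n m : 'C(n, m)%:R <= n%:R ^+ m :> R.
  rewrite -natrX ler_nat; apply: (@leq_trans (n ^_ m)).
    by rewrite -bin_ffact leq_pmulr ?fact_gt0.
  elim: m => // m IH; rewrite ffactnSr expnSr leq_mul ?leq_subr //.
have lk : k%:R * lam%:R >= 2 * lam%:R :> R.
  by rewrite ler_wpM2r ?ler0n // ler_nat.
apply: lerD.
  apply: le_trans (prob_exists_le p01 _ _) _.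
  apply: (@le_trans _ _ (\sum_(K : {set N} | #|K| == k)
                           3 * expR (- (3 * k%:R * lam%:R)))).
    apply: ler_sum => K /eqP cK; apply: le_trans (prob_or_le p01 _ _) _.
    have -> : 3 * expR (- (3 * k%:R * lam%:R)) = expR (- (3 * k%:R * lam%:R)) +
       (expR (- (3 * k%:R * lam%:R)) + expR (- (3 * k%:R * lam%:R))) :> R by ring.
    apply: lerD; first exact: few_edges.
    apply: le_trans (prob_or_le p01 _ _) _; apply: lerD.
      exact: many_overlapping.
    exact: many_single.
  rewrite sumr_const -cardsE card_draws -[leLHS]mulr_natl mulrCA ler_wpM2l //.
  apply: (@le_trans _ _ (expR (k%:R * lam%:R) * expR (- (3 * k%:R * lam%:R)))).
    rewrite ler_wpM2r ?expR_ge0 //; apply: le_trans (binle _ _) _.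
    exact: exprn_le_expR.
  by rewrite -expRD ler_expR arith_union ?ler0n.
apply: le_trans (prob_exists_le p01 _ _) _.
apply: (@le_trans _ _ (\sum_(g : {set N} | #|g| == 2%N) expR (- (4 * lam%:R)))).
  by apply: ler_sum => g /eqP; apply: long_chain.
rewrite sumr_const -cardsE card_draws -[leLHS]mulr_natl.
apply: (@le_trans _ _ (expR (2%:R * lam%:R) * expR (- (4 * lam%:R)))).
  rewrite ler_wpM2r ?expR_ge0 //; apply: le_trans (binle _ _) _.
  exact: exprn_le_expR.
by rewrite -expRD ler_expR arith_pairs.
Qed.

End BadProbability.

(** * Asymptotics *)

(** [expR x >= (x / j.+1) ^+ j.+1] for [x >= 0] beats a polynomial of degree [j]. *)
Lemma poly_expR_small (R : realType) (C alpha : R) j : 0 < alpha ->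
  exists l0, forall l : nat, (l0 <= l)%N ->
    C * l%:R ^+ j * expR (- (alpha * l%:R)) <= 1.
Proof.
move=> a0; pose b : R := (alpha / j.+1%:R) ^+ j.+1.
have b0 : 0 < b by rewrite exprn_gt0 // divr_gt0.
exists (Num.truncn (C / b)).+1 => l l0l.
have Cb : C <= b * l%:R.
  rewrite mulrC -ler_pdivrMr //; apply: le_trans (ltW (truncnS_gt _)) _.
  by rewrite ler_nat.
have := expR_gt0 (alpha * l%:R) => e0.
rewrite expRN ler_pdivrMr // mul1r.
have -> : alpha * l%:R = j.+1%:R * (alpha * l%:R / j.+1%:R).
  by rewrite [RHS]mulrC mulfVK // pnatr_eq0.
rewrite expRM_natl; apply: (@le_trans _ _ ((alpha * l%:R / j.+1%:R) ^+ j.+1)); last first.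
  rewrite lerXn2r ?nnegrE ?expR_ge0 ?divr_ge0 ?mulr_ge0 ?ler0n ?(ltW a0) //.
  by apply: le_trans (expR_ge1Dx _); rewrite lerDr.
rewrite (mulrAC alpha) exprMn -/b exprS mulrA ler_wpM2r //.
Qed.

Lemma arith_half (F : realFieldType) (x : F) : 3 <= x -> 4 * (x ^+ 2)^-1 < 1 / 2.
Proof.
by move=> x3; rewrite ltr_pdivrMr ?exprn_gt0 //; nra.
Qed.

Lemma arith_round (F : realFieldType) (d k p : F) : 0 < p -> p <= 1 -> 1 <= d ->
  d / p < k -> k <= d / p + 1 -> d <= k * p <= 2 * d.
Proof.
move=> p0 p1 d1; rewrite ltr_pdivrMr // => /ltW -> k_le /=.
apply: le_trans (ler_wpM2r (ltW p0) k_le) _.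
rewrite mulrDl mulfVK ?lt0r_neq0 // mul1r; lra.
Qed.

Lemma arith_shuffle (F : realFieldType) (a b d m x : F) :
  m * x * (a * b) * d = m * a * x * (b * d).
Proof. ring. Qed.

Lemma arith_final (F : realFieldType) (a d e k l : F) :
  k * (d * (e * a)) <= 2 * l * (d * (e * a)) ->
  2 * (d * k * (e * a)) <= 4 * d * e * (a * l).
Proof. lra. Qed.

Section DenseCase.
Variables (R : realType) (T : finType) (H : graph T).
Hypotheses (H_nonempty : verts H != finset.set0) (H_bal : strictly_2balanced H).
Hypothesis m2_gt1 : 1 < m2 H.
Local Notation v := #|{: vertex H}|.
Local Notation E := #|vedges H|.
Local Notation D := (32 * (8 * E) ^ 2)%N.
Local Notation c := ((24 * E * D)%:R^-1 : R).

Let v_gt2 : (2 < v)%N. Proof. by rewrite card_vertex dense_card_verts. Qed.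
Let v_lt_E : (v - 2 < E.-1)%N.
Proof. by rewrite card_vertex card_vedges dense_card_edges. Qed.
Let E_gt1 : (1 < E)%N. Proof. by move: v_lt_E; case: E => [|[]]. Qed.
Let edges_neq0 : edges H != finset.set0.
Proof. by rewrite -card_gt0 -card_vedges ltnW. Qed.

(** A guarantee for some [k' > k] would have to hold against the Decider who always accepts with
    probability [p], but there the probability is at most [4 * expR (- (2 * lam)) <= 4/9]. *)
Lemma RPS_le n k (q : R) lam :
  let p := c * q ^+ (v - 2) in
  0 < q <= 1 -> n%:R * q ^+ E.-1 = 1 -> (1 < lam)%N -> n%:R <= expR lam%:R :> R ->
  (D * lam)%:R <= k%:R * p <= 2 * (D * lam)%:R ->
  q * (4 * v * lam + 3)%:R ^+ v <= 1 / 6 ->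
  (8 * E ^ 2 * v * D + (v.+1) ^ v)%:R * lam%:R ^+ 2 * q *
    expR (lam%:R / (2 * E)%:R) <= 1 ->
  (RPS R H n <= k)%N.
Proof.
move=> p q01 n_q lam_gt1 n_le k_bounds q_small1 q_small2.
have [q0 q1] := andP q01.
have den0 : (0 < 24 * E * D)%N by rewrite !muln_gt0 (ltnW E_gt1).
have c01 : 0 < c <= 1 by rewrite invr_gt0 ltr0n den0 invf_le1 ?ltr0n // ler1n.
have [c0 c1] := andP c01.
have p01 : 0 <= p <= 1.
  by rewrite mulr_ge0 ?mulr_ile1 ?exprn_ile1 ?exprn_ge0 ?(ltW q0) ?(ltW c0).
apply/bigmax_leqP => k' /asboolP [s strat guar]; rewrite leqNgt; apply/negP => ltk.
have dec : decider_strategy (fun _ : history n => p) by move=> h.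
have := guar _ dec; apply/negP; rewrite -ltNge.
apply: le_lt_trans (prob_final_le (ltnW ltk) H_nonempty strat p01 edges_neq0) _.
have N_def : #|'I_n|%:R * q ^+ E.-1 = 1 by rewrite card_ord.
have N_le : #|'I_n|%:R <= expR lam%:R :> R by rewrite card_ord.
have bal := @balanced_vedges T H H_nonempty H_bal _ _ m2_gt1.
apply: le_lt_trans (prob_bad_le (card_vedge (H := H)) v_gt2 E_gt1 bal q01 c01 (erefl p)
  N_def (erefl _) lam_gt1 (erefl _) N_le k_bounds v_lt_E q_small1 q_small2) _.
have e9 : 3 <= expR lam%:R :> R.
  by apply: le_trans (expR_ge1Dx _); rewrite nat1r ler_nat.
by rewrite expRN expRM_natl arith_half.
Qed.

Lemma RPS_dense : exists2 C : R, 0 < C & exists n0 : nat, forall n, (n0 <= n)%N ->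
  (RPS R H n)%:R <= C * (n%:R `^ (1 / ratr (m2 H)) * ln n%:R).
Proof.
have E0 : 0 < E%:R :> R by rewrite ltr0n ltnW.
have E1 : 0 < E.-1%:R :> R by rewrite ltr0n; apply: leq_ltn_trans v_lt_E.
pose M : R := (8 * E ^ 2 * v * D + (v.+1) ^ v)%:R.
(* The constants anticipate [q <= expR 1 * expR (- (lam / E))]; in the second bound half of this
   decay is spent on [expR (lam / (2 * E))]. *)
have [l1 small1] := @poly_expR_small R (6 * expR 1 * (4 * v + 3)%:R ^+ v) E%:R^-1 v
  (ltac:(by rewrite invr_gt0)).
have [l2 small2] := @poly_expR_small R (M * expR 1) (2 * E)%:R^-1 2
  (ltac:(by rewrite invr_gt0 natrM mulr_gt0)).
pose l0 := maxn 2 (maxn l1 l2).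
have D_gt0 : (0 < D)%N by rewrite !muln_gt0 (ltnW E_gt1).
have den0 : 0 < (24 * E * D)%:R :> R by rewrite ltr0n !muln_gt0 (ltnW E_gt1).
(* From [k <= 2 * D * lam / p], [lam <= 2 * ln n] and [1 / p = 24 * E * D * n ^ (1 / m2 H)]. *)
exists (4 * D%:R * (24 * E * D)%:R); first by rewrite 2?mulr_gt0 // ltr0n D_gt0.
exists (Num.truncn (expR l0%:R : R)).+1 => n n0n.
have n_gt : expR l0%:R < n%:R :> R.
  by apply: lt_le_trans (truncnS_gt _) _; rewrite ler_nat.
have n_gt0 : 0 < n%:R :> R by apply: lt_trans n_gt; apply: expR_gt0.
pose l : R := ln n%:R; pose lam := (Num.truncn l).+1.
have nE : n%:R = expR l by rewrite lnK ?posrE.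
have l_gt : l0%:R < l by rewrite -ltr_expR -nE.
have l_gt1 : 1 <= l by apply: le_trans (ltW l_gt); rewrite ler1n leq_max.
have l_ge0 : 0 <= l by apply: le_trans l_gt1.
have l_lt_lam : l < lam%:R by apply: truncnS_gt.
have lam_le : lam%:R <= l + 1.
  by rewrite /lam -natr1 lerD2r truncn_le.
have l0_le : (l0 <= lam)%N by rewrite -(ler_nat R) ltW // (lt_trans l_gt).
have lam_gt1 : (1 < lam)%N by apply: leq_trans l0_le; rewrite leq_max.
have l1_le : (l1 <= lam)%N by apply: leq_trans l0_le; rewrite /l0 !leq_max leqnn orbT.
have l2_le : (l2 <= lam)%N by apply: leq_trans l0_le; rewrite /l0 !leq_max leqnn !orbT.
pose q : R := expR (- (l / E.-1%:R)).
have q0 : 0 < q by apply: expR_gt0.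
have q01 : 0 < q <= 1.
  by rewrite q0 -[leRHS]expR0 ler_expR oppr_le0 divr_ge0 ?ler0n.
have n_q : n%:R * q ^+ E.-1 = 1.
  rewrite nE /q -expRM_natl mulrN mulrCA divff ?(lt0r_neq0 E1) // mulr1.
  by rewrite expRN divff // lt0r_neq0 ?expR_gt0.
have n_le : n%:R <= expR lam%:R :> R by rewrite nE ler_expR ltW.
(* Rounding [ln n] up to [lam] costs at most a factor [expR 1], and [1 / (E - 1) >= 1 / E]. *)
have q_le : q <= expR 1 * expR (- (E%:R^-1 * lam%:R)).
  rewrite -expRD ler_expR lerNl opprD opprK addrC lerBlDl.
  apply: (@le_trans _ _ (E%:R^-1 * (l + 1))).
    by rewrite ler_wpM2l // invr_ge0 ltW.
  rewrite mulrDr mulr1 addrC lerD //.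
    by rewrite invf_le1 // ler1n ltnW.
  by rewrite mulrC ler_wpM2l // lef_pV2 ?posrE // ler_nat leq_pred.
pose p := c * q ^+ (v - 2).
have p0 : 0 < p by rewrite mulr_gt0 ?exprn_gt0 ?invr_gt0.
have p1 : p <= 1.
  rewrite mulr_ile1 ?exprn_ge0 ?exprn_ile1 ?invr_ge0 ?(ltW q0) ?(ltW den0) //.
    by rewrite invf_le1 // ler1n -(ltr0n R).
  by case/andP: q01.
have Dlam1 : 1 <= (D * lam)%:R :> R by rewrite ler1n muln_gt0 D_gt0.
pose y := (D * lam)%:R / p; pose k := (Num.truncn y).+1.
have y0 : 0 <= y by rewrite divr_ge0 ?ler0n ?(ltW p0).
have k_gt : y < k%:R by apply: truncnS_gt.
have k_le : k%:R <= y + 1 by rewrite /k -natr1 lerD2r truncn_le.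
have y1 : 1 <= y by rewrite ler_pdivlMr // mul1r (le_trans p1).
have k_bounds : (D * lam)%:R <= k%:R * p <= 2 * (D * lam)%:R.
  exact: arith_round p0 p1 Dlam1 k_gt k_le.
have q_small1 : q * (4 * v * lam + 3)%:R ^+ v <= 1 / 6.
  rewrite ler_pdivlMr //; apply: le_trans (small1 lam l1_le).
  have vle : (4 * v * lam + 3)%:R ^+ v <= (4 * v + 3)%:R ^+ v * lam%:R ^+ v :> R.
    rewrite -exprMn lerXn2r ?nnegrE ?mulr_ge0 ?ler0n // -natrM ler_nat.
    by rewrite mulnDl leq_add2l leq_pmulr.
  have le := ler_pM (ltW q0) (exprn_ge0 v (ler0n R _)) q_le vle.
  apply: le_trans (ler_wpM2r _ le) _ => //.
  rewrite le_eqVlt; apply/orP; left; apply/eqP.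
  by move: (expR _) (expR _) (_ ^+ _) (_ ^+ _) => a b d e; ring.
have q_small2 : M * lam%:R ^+ 2 * q * expR (lam%:R / (2 * E)%:R) <= 1.
  apply: le_trans (small2 lam l2_le).
  have M0 : 0 <= M * lam%:R ^+ 2 by rewrite mulr_ge0 ?exprn_ge0 ?ler0n.
  apply: (@le_trans _ _ (M * lam%:R ^+ 2 * (expR 1 * expR (- (E%:R^-1 * lam%:R))) *
      expR (lam%:R / (2 * E)%:R))).
    by rewrite ler_wpM2r ?expR_ge0 // ler_wpM2l.
  rewrite arith_shuffle -expRD.
  have -> // : - (E%:R^-1 * lam%:R) + lam%:R / (2 * E)%:R = - ((2 * E)%:R^-1 * lam%:R) :> R.
  rewrite natrM; move: (E%:R) E0 (lam%:R) => a a0 b; field; exact: lt0r_neq0.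
have RPSk := RPS_le q01 n_q lam_gt1 n_le k_bounds q_small1 q_small2.
apply: (@le_trans _ _ k%:R); first by rewrite ler_nat.
apply: (le_trans k_le); apply: (@le_trans _ _ (2 * y)).
  by rewrite mulr_natl mulr2n lerD2l.
have pV : p^-1 = (24 * E * D)%:R * n%:R `^ (1 / ratr (m2 H)).
  rewrite invfM invrK; congr (_ * _).
  rewrite /powR (gt_eqF n_gt0) -/l -exprVn /q -expRN opprK -expRM_natl; congr expR.
  have -> : ratr (m2 H) = E.-1%:R / (v - 2)%:R :> R.
    by rewrite m2_dense // fmorph_div /= !ratr_nat card_vertex card_vedges.
  by rewrite div1r invf_div mulrA mulrAC.
rewrite /y pV natrM.
have lam2 : lam%:R <= 2 * l by rewrite (le_trans lam_le) // mulr_natl mulr2n lerD2l.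
have P0 : 0 <= D%:R * ((24 * E * D)%:R * n%:R `^ (1 / ratr (m2 H))) :> R.
  by rewrite !mulr_ge0 ?ler0n ?powR_ge0.
exact: arith_final (ler_wpM2r P0 lam2).
Qed.

End DenseCase.

(** The trivial bound [n] is already at most [n ^ (1 / m2 H)], and [ln n >= 1] because
    [n >= 4 >= e]. *)
Lemma RPS_sparse (R : realType) (T : finType) (H : graph T) n :
  0 < m2 H <= 1 -> (3 < n)%N ->
  (RPS R H n)%:R <= n%:R `^ (1 / ratr (m2 H)) * ln n%:R :> R.
Proof.
case/andP => m0 m1 n2.
have RPSn : (RPS R H n <= n)%N by apply/bigmax_leqP => k _; rewrite -ltnS.
have n3 : 4 <= n%:R :> R by rewrite ler_nat.
have r0 : 0 < ratr (m2 H) :> R by rewrite ltr0q.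
have r1 : ratr (m2 H) <= 1 :> R by rewrite -(ler_rat R) rmorph1 in m1.
apply: (@le_trans _ _ n%:R); first by rewrite ler_nat.
have pown : n%:R <= n%:R `^ (1 / ratr (m2 H)) :> R.
  rewrite -{1}(powRr1 (ler0n _ n)); apply: ler_powR; first by rewrite ler1n; lia.
  by rewrite div1r invf_ge1.
apply: le_trans pown _; rewrite ler_peMr ?powR_ge0 //.
rewrite -[leLHS]expRK ler_ln ?posrE ?expR_gt0 ?(le_trans (expR1_le4 R)) //.
by rewrite (lt_le_trans _ n3).
Qed.

Local Open Scope classical_set_scope.

Theorem theorem2 (R : realType) (T : finType) (H : graph T)
    (H_nonempty : verts H != finset.set0) (H_bal : strictly_2balanced H) :
  (fun n : nat => (RPS R H n)%:R : R^o) =O_\oo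
  (fun n : nat => (n%:R `^ (1 / ratr (m2 H)) * ln n%:R : R^o)).
Proof.
have [C C0 [n0 le]] : exists2 C : R, 0 < C & exists n0 : nat, forall n, (n0 <= n)%N ->
    (RPS R H n)%:R <= C * (n%:R `^ (1 / ratr (m2 H)) * ln n%:R).
  case: (ltP 1 (m2 H)) => m1; first exact: RPS_dense.
  exists 1 => //; exists 4%N => n n3; rewrite mul1r; apply: RPS_sparse => //.
  by rewrite m2_gt0.
apply/eqO_exP; exists C => //; exists n0 => // n /= n0n.
rewrite !ger0_norm ?ler0n //; first exact: le.
(* At [n = 0] the logarithm is 0 by convention. *)
rewrite mulr_ge0 ?powR_ge0 //; case: n {n0n} => [|n]; first by rewrite ln0.
by rewrite ln_ge0 // ler1n.
Qed.
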